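(* Let $p$ be a prime, and let $\mathcal A_p$ be the class of all $2$-generated commutative automorphic loops $Q$ possessing a central subloop $Z\cong\mathbb Z_p$ such that $Q/Z\cong\mathbb Z_p\times\mathbb Z_p$. Define the following orbits of $G=\mathrm{GL}_2(p)$ on the $3$-dimensional subspaces of $Z(F_p)$. For every $p$, let $O_1=G(\langle x^p\rangle\oplus W)$ and $O_2=G(V\oplus\langle(x,x,y)\rangle)$. If $p\ne3$, let $$O_3=G(\langle x^p,\ y^p+(x,y,y),\ (x,x,y)\rangle),\qquad O_4=G(\langle y^p,\ x^p+(x,y,y),\ (x,x,y)\rangle),$$ and if $p>3$ let in addition $$O_5=G(\langle y^p,\ \lambda x^p+(x,y,y),\ (x,x,y)\rangle),$$ where $\lambda$ is not a square in $\mathbb Z_p$. If $p=3$, let $$\begin{aligned}O_3&=G(\langle x^p+(x,y,y),\ y^p,\ (x,x,y)\rangle),\\ O_4&=G(\langle x^p-(x,y,y),\ y^p,\ (x,x,y)\rangle),\\ O_5&=G(\langle x^p-(x,y,y),\ y^p+(x,y,y),\ (x,x,y)\rangle).\end{aligned}$$ Thus there are orbits $O_1,\dots,O_4$ if $p=2$, and orbits $O_1,\dots,O_5$ if $p\ge3$. For every $i$, let $N_i\in O_i$ and $Q_i=F_p/N_i$. Then every $Q\in\mathcal A_p$ is isomorphic to precisely one $Q_i$. Moreover, $Q_i$ is a group if and only if $i=1$.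
   Context: A loop is automorphic if all its inner mappings (the group generated by $L_{yx}^{-1}L_yL_x$, $R_{xy}^{-1}R_yR_x$, $L_x^{-1}R_x$, with $L_x(y)=xy$, $R_x(y)=yx$) are automorphisms. Elements of $\mathbb Z_p$ are identified with the integers $0,\dots,p-1$. For $0\le a,b<p$ let $(a,b)_p=0$ if $a+b<p$ and $(a,b)_p=1$ otherwise. $F_p$ is the commutative automorphic loop on $(\mathbb Z_p)^6$ with multiplication $$(a_1,\dots,a_6)(b_1,\dots,b_6)=(a_1+b_1,\ a_2+b_2,\ a_3+b_3+(a_1,b_1)_p,\ a_4+b_4+(a_2,b_2)_p,\ a_5+b_5-a_1b_1(a_2+b_2),\ a_6+b_6+a_2b_2(a_1+b_1)).$$ It is generated by $x=(1,0,0,0,0,0)$ and $y=(0,1,0,0,0,0)$. The associator is defined by $(ab)c=(a(bc))(a,b,c)$. The center $Z(F_p)=0\times0\times(\mathbb Z_p)^4$ is written additively as a $4$-dimensional vector space over $\mathbb Z_p$ with basis $x^p=(0,0,1,0,0,0)$, $y^p=(0,0,0,1,0,0)$, $(x,x,y)=(0,0,0,0,1,0)$, $(x,y,y)=(0,0,0,0,0,1)$. Let $V=\langle x^p\rangle\oplus\langle y^p\rangle$ and $W=\langle(x,x,y)\rangle\oplus\langle(x,y,y)\rangle$, where $\langle\cdot\rangle$ denotes linear span. The group $G=\mathrm{GL}_2(p)$ acts on $Z(F_p)$: $\rho=\begin{pmatrix}\alpha_1&\alpha_2\\ \beta_1&\beta_2\end{pmatrix}$ acts as the restriction to $Z(F_p)$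 of the automorphism $\widehat\rho$ of $F_p$ determined by $\widehat\rho(x)=x^{\alpha_1}y^{\alpha_2}=(\alpha_1,\alpha_2,0,0,0,0)$, $\widehat\rho(y)=x^{\beta_1}y^{\beta_2}=(\beta_1,\beta_2,0,0,0,0)$. For a subspace $N$ of $Z(F_p)$, $G(N)=\{\widehat\rho(N):\rho\in G\}$ denotes its orbit. *)

(* Defs.v *)
From HB Require Import structures.
From mathcomp Require Import all_boot all_order all_fingroup all_algebra.
From mathcomp Require Import generic_quotient ring.

Set Implicit Arguments.
Unset Strict Implicit.
Unset Printing Implicit Defensive.

Import GRing.Theory.

Local Open Scope quotient_scope.
Local Open Scope group_scope.

(* [ldiv x y] is x \ y, i.e. L_x^{-1}(y); [rdiv y x] is y / x, i.e.
   R_x^{-1}(y). The MathComp notation x / y is not used for loops. *)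
HB.mixin Record isLoop Q of UMagma Q := {
  ldiv : Q -> Q -> Q;
  rdiv : Q -> Q -> Q;
  ldivK : forall x y : Q, x * ldiv x y = y;
  ldivKV : forall x y : Q, ldiv x (x * y) = y;
  rdivK : forall x y : Q, rdiv y x * x = y;
  rdivKV : forall x y : Q, rdiv (y * x) x = y
}.

#[short(type="loopType")]
HB.structure Definition Loop := {Q of isLoop Q & UMagma Q}.

Definition is_isom (A B : magmaType) (f : A -> B) : Prop :=
  bijective f /\ {morph f : x y / x * y}.

Definition isomorphic (A B : magmaType) : Prop :=
  exists f : A -> B, is_isom f.

Section LoopNotions.
Variable Q : loopType.

Definition Ltrans (x y : Q) : Q := x * y.
Definition Rtrans (x y : Q) : Q := y * x.

Inductive inner : (Q -> Q) -> Prop :=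
  | inner_L x y : inner (ldiv (y * x) \o (Ltrans y \o Ltrans x))
  | inner_R x y : inner (rdiv^~ (x * y) \o (Rtrans y \o Rtrans x))
  | inner_T x : inner (ldiv x \o Rtrans x)
  | inner_id : inner id
  | inner_comp f g : inner f -> inner g -> inner (f \o g)
  | inner_inv f g : inner f -> cancel f g -> cancel g f -> inner g.

Definition automorphic : Prop := forall f, inner f -> is_isom f.

Definition is_commutative : Prop := commutative ( *%g : Q -> Q -> Q).

(* A group is an associative loop. *)
Definition is_group : Prop := associative ( *%g : Q -> Q -> Q).

Definition subloop_closed (S : {pred Q}) : Prop :=
  [/\ 1 \in S,
      {in S &, forall x y, x * y \in S},
      {in S &, forall x y, ldiv x y \in S}
    & {in S &, forall x y, rdiv x y \in S}].

Definition two_generated : Prop :=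
  exists a b : Q, forall S : {pred Q},
    subloop_closed S -> a \in S -> b \in S -> forall x, x \in S.

Definition central (z : Q) : Prop :=
  forall x y : Q, [/\ z * x = x * z,
                      z * (x * y) = (z * x) * y,
                      x * (z * y) = (x * z) * y
                    & x * (y * z) = (x * y) * z].

Record subloop := Subloop {
  subloop_pred :> {pred Q};
  subloopP : subloop_closed subloop_pred
}.

Record centralSubloop := CentralSubloop {
  csl_subloop :> subloop;
  csl_central : {in csl_subloop, forall z, central z}
}.

End LoopNotions.

Section SubloopLoop.
Variables (Q : loopType) (S : subloop Q).

Record subloop_type := SubloopElt {
  subloop_val : Q;
  subloop_valP : subloop_val \in S
}.
HB.instance Definition _ := [isSub for subloop_val].
HB.instance Definition _ := [Choice of subloop_type by <:].

Let closedM : umagma_closed S.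
Proof. by case: (subloopP S). Qed.
HB.instance Definition _ :=
  SubChoice_isSubUMagma.Build Q (mem S) subloop_type closedM.

Let closed_ldiv (x y : subloop_type) : ldiv (val x) (val y) \in S.
Proof. by case: (subloopP S) => _ _ h _; apply: h; apply: valP. Qed.
Let closed_rdiv (x y : subloop_type) : rdiv (val x) (val y) \in S.
Proof. by case: (subloopP S) => _ _ _ h; apply: h; apply: valP. Qed.

Definition subloop_ldiv (x y : subloop_type) : subloop_type :=
  SubloopElt (closed_ldiv x y).
Definition subloop_rdiv (x y : subloop_type) : subloop_type :=
  SubloopElt (closed_rdiv x y).

Let lK (x y : subloop_type) : x * subloop_ldiv x y = y.
Proof. by apply: val_inj; rewrite valM; apply: ldivK. Qed.
Let lKV (x y : subloop_type) : subloop_ldiv x (x * y) = y.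
Proof. by apply: val_inj; apply: (etrans (congr1 _ (valM x y)) (ldivKV _ _)). Qed.
Let rK (x y : subloop_type) : subloop_rdiv y x * x = y.
Proof. by apply: val_inj; rewrite valM; apply: rdivK. Qed.
Let rKV (x y : subloop_type) : subloop_rdiv (y * x) x = y.
Proof. by apply: val_inj; apply: (etrans (congr1 (rdiv^~ _) (valM y x)) (rdivKV _ _)). Qed.

HB.instance Definition _ := isLoop.Build subloop_type lK lKV rK rKV.

End SubloopLoop.

Section Quotient.
Variables (Q : loopType) (Z : centralSubloop Q).

(* x and y lie in the same coset: y \in xZ. *)
Definition coset_rel : rel Q := fun x y => ldiv x y \in Z.

Lemma coset_relP x y : reflect (exists2 z, z \in Z & y = x * z) (coset_rel x y).
Proof.
apply: (iffP idP) => [h|[z zZ ->]]; last by rewrite /coset_rel ldivKV.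
by exists (ldiv x y) => //; rewrite ldivK.
Qed.

Lemma coset_rel_refl : reflexive coset_rel.
Proof.
move=> x; apply/coset_relP; exists 1; last by rewrite mulg1.
by case: (subloopP Z).
Qed.

Let trans_ x y z : coset_rel x y -> coset_rel y z -> coset_rel x z.
Proof.
move=> /coset_relP[u uZ ->] /coset_relP[v vZ ->]; apply/coset_relP.
exists (u * v); first by case: (subloopP Z) => _ h _ _; apply: h.
by case: (csl_central vZ x u).
Qed.

Let sym_ x y : coset_rel x y -> coset_rel y x.
Proof.
move=> /coset_relP[u uZ ->]; apply/coset_relP.
have [Z1 _ ZL _] := subloopP Z.
have vZ : ldiv u 1 \in Z by apply: ZL.
exists (ldiv u 1) => //.
have [_ _ _ <-] := csl_central vZ x u.
by rewrite ldivK mulg1.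
Qed.

Lemma coset_rel_sym : symmetric coset_rel.
Proof. by move=> x y; apply/idP/idP; apply: sym_. Qed.

Lemma coset_rel_trans : transitive coset_rel.
Proof. by move=> y x z; apply: trans_. Qed.

Canonical coset_equiv :=
  EquivRel coset_rel coset_rel_refl coset_rel_sym coset_rel_trans.

Definition loop_quot := {eq_quot coset_equiv}.
HB.instance Definition _ := Choice.on loop_quot.
HB.instance Definition _ := EqQuotient.on loop_quot.

Let piE (x y : Q) :
  (\pi_loop_quot x = \pi_loop_quot y) <-> coset_rel x y.
Proof. by split=> [/eqmodP|h]; last apply/eqmodP. Qed.

Let rel_mul x x' y y' :
  coset_rel x x' -> coset_rel y y' -> coset_rel (x * y) (x' * y').
Proof.
move=> /coset_relP[u uZ ->] /coset_relP[v vZ ->]; apply/coset_relP.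
exists (u * v); first by case: (subloopP Z) => _ h _ _; apply: h.
have [_ _ _ ->] := csl_central vZ (x * u) y.
have [_ _ <- _] := csl_central uZ x y.
have [-> _ _ _] := csl_central uZ y 1.
have [_ _ _ ->] := csl_central uZ x y.
by have [_ _ _ <-] := csl_central vZ (x * y) u.
Qed.

Let rel_ldiv x x' y y' :
  coset_rel x x' -> coset_rel y y' -> coset_rel (ldiv x y) (ldiv x' y').
Proof.
move=> /coset_relP[u uZ ->] /coset_relP[v vZ ->]; apply/coset_relP.
have [_ _ ZL _] := subloopP Z.
have wZ : ldiv u v \in Z by apply: ZL.
exists (ldiv u v) => //.
rewrite -[RHS](ldivKV (x * u)); congr ldiv.
have [_ _ <- _] := csl_central uZ x (ldiv x y * ldiv u v).
have [_ -> _ _] := csl_central uZ (ldiv x y) (ldiv u v).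
have [-> _ _ _] := csl_central uZ (ldiv x y) 1.
have [_ _ _ <-] := csl_central wZ (ldiv x y) u.
rewrite ldivK.
have [_ _ _ ->] := csl_central vZ x (ldiv x y).
by rewrite ldivK.
Qed.

Let rel_rdiv x x' y y' :
  coset_rel x x' -> coset_rel y y' -> coset_rel (rdiv y x) (rdiv y' x').
Proof.
move=> /coset_relP[u uZ ->] /coset_relP[v vZ ->]; apply/coset_relP.
have [_ _ ZL _] := subloopP Z.
have wZ : ldiv u v \in Z by apply: ZL.
exists (ldiv u v) => //.
rewrite -[RHS](rdivKV (x * u)); congr rdiv.
have [_ _ _ ->] := csl_central uZ (rdiv y x * ldiv u v) x.
have [_ _ <- _] := csl_central wZ (rdiv y x) x.
have [-> _ _ _] := csl_central wZ x 1.
have [_ _ _ ->] := csl_central wZ (rdiv y x) x.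
have [_ _ _ <-] := csl_central uZ (rdiv y x * x) (ldiv u v).
have [<- _ _ _] := csl_central uZ (ldiv u v) 1.
by rewrite rdivK ldivK.
Qed.

Definition quot_one : loop_quot := \pi_loop_quot 1.
Definition quot_mul (x y : loop_quot) : loop_quot := \pi_loop_quot (repr x * repr y).
Definition quot_ldiv (x y : loop_quot) : loop_quot :=
  \pi_loop_quot (ldiv (repr x) (repr y)).
Definition quot_rdiv (x y : loop_quot) : loop_quot :=
  \pi_loop_quot (rdiv (repr x) (repr y)).

Let repr_pi x : coset_rel (repr (\pi_loop_quot x)) x.
Proof. by apply/piE; rewrite reprK. Qed.

HB.instance Definition _ := hasMul.Build loop_quot quot_mul.

Lemma pi_mulE (x y : Q) :
  \pi_loop_quot (x * y) = \pi_loop_quot x * \pi_loop_quot y.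
Proof. by apply/piE; rewrite coset_rel_sym; apply: rel_mul. Qed.

Let pi_ldiv (x y : Q) :
  \pi_loop_quot (ldiv x y) = quot_ldiv (\pi_loop_quot x) (\pi_loop_quot y).
Proof. by apply/piE; rewrite coset_rel_sym; apply: rel_ldiv. Qed.

Let pi_rdiv (x y : Q) :
  \pi_loop_quot (rdiv y x) = quot_rdiv (\pi_loop_quot y) (\pi_loop_quot x).
Proof. by apply/piE; rewrite coset_rel_sym; apply: rel_rdiv. Qed.

Let mul1 : left_id quot_one *%g.
Proof.
by move=> x; rewrite -[x]reprK -pi_mulE mul1g.
Qed.
Let mulr1 : right_id quot_one *%g.
Proof.
by move=> x; rewrite -[x]reprK -pi_mulE mulg1.
Qed.

HB.instance Definition _ := Magma_isUMagma.Build loop_quot mul1 mulr1.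

Let lK (x y : loop_quot) : x * quot_ldiv x y = y.
Proof. by rewrite -[x]reprK -[y]reprK -pi_ldiv -pi_mulE ldivK. Qed.
Let lKV (x y : loop_quot) : quot_ldiv x (x * y) = y.
Proof. by rewrite -[x]reprK -[y]reprK -pi_mulE -pi_ldiv ldivKV. Qed.
Let rK (x y : loop_quot) : quot_rdiv y x * x = y.
Proof. by rewrite -[x]reprK -[y]reprK -pi_rdiv -pi_mulE rdivK. Qed.
Let rKV (x y : loop_quot) : quot_rdiv (y * x) x = y.
Proof. by rewrite -[x]reprK -[y]reprK -pi_mulE -pi_rdiv rdivKV. Qed.

HB.instance Definition _ := isLoop.Build loop_quot lK lKV rK rKV.

End Quotient.

(* MathComp's group structure on 'F_p is the additive one, and the one on a
   product type is componentwise, so that 'F_p and 'F_p * 'F_p are here the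
   groups Z_p and Z_p x Z_p. *)
Definition class_A (p : nat) (Q : loopType) : Prop :=
  [/\ two_generated Q, is_commutative Q, automorphic Q
    & exists Z : centralSubloop Q,
        isomorphic (subloop_type Z) 'F_p
        /\ isomorphic (loop_quot Z) ('F_p * 'F_p)%type].

Local Open Scope ring_scope.

Definition vec6 (p : nat) (a1 a2 a3 a4 a5 a6 : 'F_p) : 'rV['F_p]_6 :=
  \row_i [:: a1; a2; a3; a4; a5; a6]`_i.

Lemma vec6E (p : nat) (a1 a2 a3 a4 a5 a6 : 'F_p) :
  let v := vec6 a1 a2 a3 a4 a5 a6 in
  (v 0 0 = a1) * (v 0 1 = a2) * (v 0 2 = a3) * (v 0 3 = a4)
  * (v 0 4 = a5) * (v 0 5 = a6).
Proof. by rewrite /= /vec6 !mxE. Qed.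

Lemma vec6_eta (p : nat) (v : 'rV['F_p]_6) :
  v = vec6 (v 0 0) (v 0 1) (v 0 2) (v 0 3) (v 0 4) (v 0 5).
Proof.
apply/rowP => -[[|[|[|[|[|[|//]]]]]] lti]; rewrite !mxE /=;
  by congr (v 0 _); apply: val_inj.
Qed.

(* The alias keeps the loop product apart from the structure of a vector
   space, which is the additive structure used on the center. *)
Definition Floop (p : nat) := 'rV['F_p]_6.

Section FLoop.
Variable p : nat.
Notation F := (Floop p).

(* #|'F_p| is p when p is prime (card_Fp); with it, F_mul is a loop operation
   for every p. *)
Definition carry (a b : 'F_p) : 'F_p :=
  if (val a + val b < #|'F_p|)%N then 0 else 1.

(* The coordinates a_1, ..., a_6 of a are [a 0 0], ..., [a 0 5]. *)
Definition F_mul (a b : F) : F :=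
  vec6 (a 0 0 + b 0 0)
       (a 0 1 + b 0 1)
       (a 0 2 + b 0 2 + carry (a 0 0) (b 0 0))
       (a 0 3 + b 0 3 + carry (a 0 1) (b 0 1))
       (a 0 4 + b 0 4 - a 0 0 * b 0 0 * (a 0 1 + b 0 1))
       (a 0 5 + b 0 5 + a 0 1 * b 0 1 * (a 0 0 + b 0 0)).

Definition F_one : F := vec6 0 0 0 0 0 0.

(* The solution b of F_mul a b = c. *)
Definition F_ldiv (a c : F) : F :=
  vec6 (c 0 0 - a 0 0)
       (c 0 1 - a 0 1)
       (c 0 2 - a 0 2 - carry (a 0 0) (c 0 0 - a 0 0))
       (c 0 3 - a 0 3 - carry (a 0 1) (c 0 1 - a 0 1))
       (c 0 4 - a 0 4 + a 0 0 * (c 0 0 - a 0 0) * c 0 1)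
       (c 0 5 - a 0 5 - a 0 1 * (c 0 1 - a 0 1) * c 0 0).

HB.instance Definition _ := Choice.on F.

Lemma carryC (a b : 'F_p) : carry a b = carry b a.
Proof. by rewrite /carry addnC. Qed.

Lemma F_mulC : commutative F_mul.
Proof.
move=> a b; rewrite /F_mul; congr vec6; rewrite 1?(carryC (b 0 _)) //; ring.
Qed.

Lemma F_mul1 : left_id F_one F_mul.
Proof.
move=> a; rewrite [RHS]vec6_eta /F_mul /F_one !vec6E /carry.
rewrite card_ord /= !add0n !ltn_ord.
by congr vec6; ring.
Qed.

Lemma F_ldivK a b : F_mul a (F_ldiv a b) = b.
Proof.
rewrite [RHS]vec6_eta /F_mul /F_ldiv !vec6E; congr vec6; ring.
Qed.

Lemma F_ldivKV a b : F_ldiv a (F_mul a b) = b.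
Proof.
rewrite [RHS]vec6_eta /F_mul /F_ldiv !vec6E.
have e i : a 0 i + b 0 i - a 0 i = b 0 i by rewrite addrC addKr.
by rewrite !e; congr vec6; ring.
Qed.

Let F_mulr1 : right_id F_one F_mul.
Proof. by move=> a; rewrite F_mulC F_mul1. Qed.
Let F_rdivK a b : F_mul (F_ldiv a b) a = b.
Proof. by rewrite F_mulC F_ldivK. Qed.
Let F_rdivKV a b : F_ldiv a (F_mul b a) = b.
Proof. by rewrite F_mulC F_ldivKV. Qed.

HB.instance Definition _ := hasMul.Build F F_mul.
HB.instance Definition _ := Magma_isUMagma.Build F F_mul1 F_mulr1.
HB.instance Definition _ :=
  isLoop.Build F F_ldivK F_ldivKV F_rdivK F_rdivKV.

Definition gen_x : F := vec6 1 0 0 0 0 0.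
Definition gen_y : F := vec6 0 1 0 0 0 0.

(* The basis x^p, y^p, (x,x,y), (x,y,y) of the center. Subspaces of the center
   are subspaces of 'rV_6: there the loop product is the vector sum. *)
Definition xp : 'rV['F_p]_6 := vec6 0 0 1 0 0 0.
Definition yp : 'rV['F_p]_6 := vec6 0 0 0 1 0 0.
Definition xxy : 'rV['F_p]_6 := vec6 0 0 0 0 1 0.
Definition xyy : 'rV['F_p]_6 := vec6 0 0 0 0 0 1.

Definition spaceV : {vspace 'rV['F_p]_6} := (<[xp]> + <[yp]>)%VS.
Definition spaceW : {vspace 'rV['F_p]_6} := (<[xxy]> + <[xyy]>)%VS.

(* h is the automorphism that rho determines. It is unique, as gen_x and gen_y
   generate F; the images are x^alpha1 y^alpha2 and x^beta1 y^beta2. *)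
Definition is_hat (rho : {'GL_2['F_p]}) (h : F -> F) : Prop :=
  [/\ is_isom h,
      h gen_x = vec6 (rho 0 0) (rho 0 1) 0 0 0 0
    & h gen_y = vec6 (rho 1 0) (rho 1 1) 0 0 0 0].

(* The orbit G(N0), as a predicate on the subsets N of F: N is h(N0) for
   some rho. *)
Definition in_GLorbit (N0 : {vspace 'rV['F_p]_6}) (N : {pred F}) : Prop :=
  exists rho : {'GL_2['F_p]}, exists2 h : F -> F, is_hat rho h
    & forall v : F, v \in N <-> exists2 u : F, u \in N0 & v = h u.

Definition num_orbits : nat := if p == 2 then 4 else 5.

(* The representative of the orbit O_i, for 1 <= i <= num_orbits; lambda is
   only used for i = 5 and p > 3. *)
Definition orbit_rep (lambda : 'F_p) (i : nat) : {vspace 'rV['F_p]_6} :=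
  match i with
  | 1 => (<[xp]> + spaceW)%VS
  | 2 => (spaceV + <[xxy]>)%VS
  | 3 => if p == 3 then <<[:: (xp + xyy)%R; yp; xxy]>>%VS
         else <<[:: xp; (yp + xyy)%R; xxy]>>%VS
  | 4 => if p == 3 then <<[:: (xp - xyy)%R; yp; xxy]>>%VS
         else <<[:: yp; (xp + xyy)%R; xxy]>>%VS
  | 5 => if p == 3 then <<[:: (xp - xyy)%R; (yp + xyy)%R; xxy]>>%VS
         else <<[:: yp; (lambda *: xp + xyy)%R; xxy]>>%VS
  | _ => 0%VS
  end.

End FLoop.

(* Main.v *)
From HB Require Import structures.
Require Import Defs.
From mathcomp Require Import all_boot all_order all_fingroup all_algebra.
From mathcomp Require Import cyclic generic_quotient ring zify.

Set Implicit Arguments.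
Unset Strict Implicit.
Unset Printing Implicit Defensive.

Import GRing.Theory.
Local Open Scope ring_scope.

(** Let U be Z_p x Z_p. A loop Q of the class is a central extension of U by
    Z_p: it lives on U x Z_p with (u,s)(v,t) = (u+v, s+t+theta(u,v)) for a
    2-cochain theta, which is symmetric because Q is commutative.

    Write D for the coboundary of theta, D(a,b,c) = theta(b,c) - theta(a+b,c)
    + theta(a,b+c) - theta(a,b); it gives the associators of Q. The inner map
    attached to a and b sends (c,t) to (c, t+D(a,b,c)), so that Q is
    automorphic exactly when D is additive in its last argument. Symmetry of
    theta says D(c,b,a) = -D(a,b,c), which carries additivity to the first
    argument, and the cocycle identity of D then carries it to the middle one.
    Hence D is trilinear and alternating in its outer arguments, that is,
    D(a,b,c) = -det(a,c) L(b) for a linear form L on U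
    (coboundary3_trilinear).

    The polynomial part of the multiplication of F_p realises every such D.
    Once it is subtracted, what is left is a symmetric cocycle of abelian
    groups, and this is determined, up to a coboundary, by the p-th powers
    P(e1), P(e2) of lifts of the two basis vectors: it is a combination of the
    two carries (cocycle_trivial). So Q is the extension given by a standard
    cocycle with parameters (P, L), four scalars altogether
    (cohomologous_std). This is the quotient of F_p by the kernel of the
    linear form (P, L) on the center; two generators cannot suffice when
    (P, L) = 0, so this form is nonzero and its kernel has dimension 3.

    It remains to classify the pairs (P, L). Since the parameters are read off
    from p-th powers and associators, a change of basis of U with matrix
    (a, c) replaces them by the powers of a, c and by
    det(a,c) (L(a), L(c)) (ext_std_basis_map). Conversely an isomorphism
    between extensions that are not associative maps associators to
    associators. These fill Z_p, so the isomorphism induces an invertible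
    linear map on U and a nonzero scalar on Z_p, and these relate the p-th
    power maps and the forms L (ext_std_iso).

    For p <> 3 the p-th power map is the linear form P itself. The
    pairs (P, L) <> 0 fall into the orbits L = 0, P = 0, P and L nonzero and
    proportional, and P and L independent; a base change multiplies
    det(P, L) by a square, so the last case splits in two for odd p. For
    p = 3 the p-th power map has in addition a cubic part coming from L, and
    the finitely many pairs and base changes over F_3 are enumerated. The
    extension is a group exactly when L = 0, which is the first orbit. *)

(** * Cochains on Z_p x Z_p *)

Section Cochains.
Variable p : nat.
Hypothesis p_pr : prime p.
Notation F := 'F_p.
Notation U := ('F_p * 'F_p)%type.
Implicit Types (u v w a b c : U) (theta : U -> U -> F) (P L : U).

Definition coboundary3 theta a b c : F :=
  theta b c - theta (a + b) c + theta a (b + c) - theta a b.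

Definition coboundary2 (tau : U -> F) u v : F := tau (u + v) - tau u - tau v.

(** The product of p copies of (u, 0) in the extension by theta is (0, t) with
    t this sum. *)
Definition pth_power theta u : F := \sum_(k < p) theta (u *+ k) u.

Definition det2 u v : F := u.1 * v.2 - u.2 * v.1.
Definition dot u v : F := u.1 * v.1 + u.2 * v.2.

Definition e1 : U := (1, 0).
Definition e2 : U := (0, 1).

(** The multiplication of F_p after a linear form has been applied to its
    center: P holds the values of the form at x^p and y^p, and L its values at
    (x,x,y) and (x,y,y). *)
Definition std_cocycle P L u v : F :=
  P.1 * carry u.1 v.1 + P.2 * carry u.2 v.2
  + (L.2 * (u.2 * v.2 * (u.1 + v.1)) - L.1 * (u.1 * v.1 * (u.2 + v.2))).

Lemma dot_eq1 P : P != 0 -> exists u, dot P u = 1.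
Proof.
move=> P0; have [q1|q1] := eqVneq P.1 0; last first.
  by exists (P.1^-1, 0); rewrite /dot /= mulr0 addr0 divff.
have [q2|q2] := eqVneq P.2 0; last first.
  by exists (0, P.2^-1); rewrite /dot /= mulr0 add0r divff.
by case/eqP: P0; rewrite [P]surjective_pairing q1 q2.
Qed.

Lemma natr_p : p%:R = 0 :> F.
Proof. exact: pchar_Fp_0. Qed.

Lemma natr_val (x : F) : (val x)%:R = x.
Proof. exact: natr_Zp. Qed.

Lemma mulr_p u : u *+ p = 0.
Proof.
by apply: injective_projections; rewrite !raddfMn /= -mulr_natr natr_p mulr0.
Qed.

Lemma carry0 (x : F) : carry 0 x = 0.
Proof. by rewrite /carry add0n card_ord ltn_ord. Qed.

Lemma val_lt (x : F) : (x < p)%N.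
Proof. by have := ltn_ord x; rewrite [X in (_ < X)%N](Fp_cast p_pr). Qed.

Lemma carry_nat (x y : F) :
  exists2 k : nat, carry x y = k%:R & (val x + val y = val (x + y)%R + p * k)%N.
Proof.
have -> : val (x + y) = ((val x + val y) %% p)%N.
  by rewrite -val_Fp_nat // natrD !natr_val.
have := val_lt x; have := val_lt y.
rewrite /carry card_Fp //=; move: (x : nat) (y : nat) => m n lx ly.
case: ltnP => h; first by exists 0%N; rewrite ?muln0 ?addn0 ?modn_small.
exists 1%N; rewrite // muln1 -{2}(subnK h) modnDr modn_small ?subnK //; lia.
Qed.

(** Both sides count how often p has to be subtracted from the sum of the
    three representatives. *)
Lemma carry_cocycle (x y z : F) :
  carry y z + carry x (y + z) = carry (x + y) z + carry x y.
Proof.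
have [k1 -> h1] := carry_nat y z; have [k2 -> h2] := carry_nat x (y + z).
have [k3 -> h3] := carry_nat (x + y) z; have [k4 -> h4] := carry_nat x y.
rewrite -!natrD; congr _%:R; apply/eqP.
move: h1 h2 h3 h4; rewrite addrA -(eqn_pmul2l (prime_gt0 p_pr)) !mulnDr.
move: (val _) (val _) (val _) (val _) (val _) (val _) => *; lia.
Qed.

(** Adding x to itself n times overflows as often as p fits into the integer
    n x. *)
Lemma sum_carry_nat (x : F) n :
  exists2 m : nat, \sum_(k < n) carry (x *+ k) x = m%:R
    & (n * val x = val (x *+ n)%R + p * m)%N.
Proof.
elim: n => [|n [m em hm]]; first by exists 0%N; rewrite ?big_ord0 ?muln0.
have [k ek hk] := carry_nat (x *+ n) x; exists (m + k)%N.
  by rewrite big_ord_recr /= em ek natrD.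
by move: hm hk; rewrite -mulrSr; move: (val _) (val _) (val _) => *; nia.
Qed.

Lemma sum_carry (x : F) : \sum_(k < p) carry (x *+ k) x = x.
Proof.
have [m -> h] := sum_carry_nat x p.
move: h; have ->: x *+ p = 0 by rewrite -mulr_natr natr_p mulr0.
move=> /= /eqP; rewrite add0n.
by rewrite eqn_pmul2l ?prime_gt0 // => /eqP <-; rewrite natr_val.
Qed.

Lemma pair_mulrn u n : u *+ n = (u.1 *+ n, u.2 *+ n).
Proof. by elim: n => [|n IH]; rewrite ?mulr0n // !mulrS IH. Qed.

(** The coefficient with which the cubic part of a standard cocycle enters the
    p-th power map; it is (p-1)p(p+1)/3, nonzero modulo p only for p = 3. *)
Definition sum_consecutive : F := \sum_(k < p) k%:R * (k.+1)%:R.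

Lemma std_sym P L u v : std_cocycle P L u v = std_cocycle P L v u.
Proof. by rewrite /std_cocycle !(carryC v.1) !(carryC v.2); ring. Qed.

Lemma std0 P L v : std_cocycle P L 0 v = 0.
Proof. by rewrite /std_cocycle /= !carry0; ring. Qed.

Lemma coboundary3_std P L a b c :
  coboundary3 (std_cocycle P L) a b c = - (det2 a c * dot L b).
Proof.
have h1 := carry_cocycle a.1 b.1 c.1; have h2 := carry_cocycle a.2 b.2 c.2.
rewrite /coboundary3 /std_cocycle /det2 /dot /=.
have -> : carry b.1 c.1 =
    carry (a.1 + b.1) c.1 + carry a.1 b.1 - carry a.1 (b.1 + c.1).
  by rewrite -h1 addrK.
have -> : carry b.2 c.2 =
    carry (a.2 + b.2) c.2 + carry a.2 b.2 - carry a.2 (b.2 + c.2).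
  by rewrite -h2 addrK.
ring.
Qed.

(** At (k u, u) the polynomial part is k(k+1) times a cubic form in u, and the
    carries along the multiples of a coordinate add up to that coordinate. *)
Lemma power_std P L u :
  pth_power (std_cocycle P L) u =
  dot P u + sum_consecutive * (u.1 * u.2 * (L.2 * u.2 - L.1 * u.1)).
Proof.
rewrite /pth_power /sum_consecutive /dot mulr_suml.
rewrite -{1}(sum_carry u.1) -{1}(sum_carry u.2) !mulr_sumr -!big_split /=.
apply: eq_bigr => k _; rewrite /std_cocycle pair_mulrn /=.
by rewrite -!(mulr_natl u.1) -!(mulr_natl u.2) mulrSr; ring.
Qed.

Lemma sum_consecutive0 : p != 3 -> sum_consecutive = 0.
Proof.
move=> p3; have n3 : 3%:R != 0 :> F.
  by rewrite -(dvdn_pcharf (pchar_Fp p_pr)) dvdn_prime2.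
apply: (mulfI n3); rewrite mulr0.
have h n : 3%:R * \sum_(k < n) k%:R * (k.+1)%:R = n%:R * (n%:R ^+ 2 - 1) :> F.
  elim: n => [|n IH]; first by rewrite big_ord0 mulr0 mul0r.
  by rewrite big_ord_recr mulrDr IH /= mulrSr; ring.
by rewrite h natr_p mul0r.
Qed.

Lemma pairE u : u = e1 *+ val u.1 + e2 *+ val u.2.
Proof.
case: u => x y; rewrite !pair_mulrn /= !mul0rn.
by congr pair; rewrite /= ?addr0 ?add0r natr_val.
Qed.

Lemma additive_dot (f : U -> F) : {morph f : u v / u + v} ->
  forall u, f u = u.1 * f e1 + u.2 * f e2.
Proof.
move=> fD u.
have f0 : f 0 = 0 by apply: (addrI (f 0)); rewrite -fD !addr0.
have fM v n : f (v *+ n) = f v *+ n.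
  by elim: n => [|n IH]; rewrite ?mulr0n // !mulrS fD IH.
by rewrite {1}(pairE u) fD !fM -!(mulr_natl (f _)) !natr_val.
Qed.

(** * The coboundary of a symmetric cochain *)

Section Symmetric.
Variable theta : U -> U -> F.
Hypothesis thC : forall u v, theta u v = theta v u.
Hypothesis th0 : forall v, theta 0 v = 0.
Notation D := (coboundary3 theta).

Lemma coboundary3_anti a b c : D c b a = - D a b c.
Proof.
rewrite /coboundary3 [in theta (c + b)]addrC [b + a]addrC.
by rewrite (thC b a) (thC _ a) (thC c) (thC c b); ring.
Qed.

Lemma coboundary3_alt a b : D a b a = 0.
Proof. by rewrite /coboundary3 (thC b a) (thC (a + b)) (addrC b); ring. Qed.

(** Antisymmetry transports additivity from the last to the first argument;
    the identity saying that a coboundary is a cocycle then expresses the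
    defect of additivity in the middle by the defects in the outer arguments.
    An alternating bilinear form on a plane is a multiple of the
    determinant. *)
Lemma coboundary3_trilinear :
  (forall a b, {morph D a b : c d / c + d}) ->
  forall a b c, D a b c = det2 a c * (b.1 * D e1 e1 e2 + b.2 * D e1 e2 e2).
Proof.
move=> add3 a b c.
have add1 b' c' : {morph (fun a' => D a' b' c') : x y / x + y}.
  by move=> x y; rewrite /= !(coboundary3_anti c') add3 opprD.
have add2 a' c' : {morph (fun b' => D a' b' c') : x y / x + y}.
  move=> x y /=; apply/eqP; rewrite -subr_eq0.
  have := add3 a' x y c'; have := add1 y c' a' x => /= h1 h3.
  have -> : D a' (x + y) c' - (D a' x c' + D a' y c') =
      (D (a' + x) y c' - (D a' y c' + D x y c'))
      + (D a' x (y + c') - (D a' x y + D a' x c')).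
    by rewrite /coboundary3 !addrA; ring.
  by rewrite h1 h3 !subrr addr0.
rewrite (additive_dot (add1 b c)) /= (additive_dot (add3 e1 b) c).
rewrite (additive_dot (add3 e2 b) c) !coboundary3_alt.
rewrite (coboundary3_anti e1 b e2) (additive_dot (add2 e1 e2) b) /= /det2.
by ring.
Qed.

(** * Symmetric cocycles of abelian groups *)

Section Cocycle.
Hypothesis thD : forall a b c, D a b c = 0.

(** The Z_p-component of (u, 0)^n in the abelian group extending U by Z_p. *)
Definition partial_power (u : U) n : F := \sum_(k < n) theta (u *+ k) u.

Lemma partial_powerD u m n :
  partial_power u (m + n) = partial_power u m + partial_power u n
                            + theta (u *+ m) (u *+ n).
Proof.
elim: n => [|n IH].
  by rewrite /partial_power big_ord0 addn0 mulr0n thC th0 !addr0.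
have h k : partial_power u k.+1 = partial_power u k + theta (u *+ k) u.
  by rewrite /partial_power big_ord_recr.
rewrite addnS !h IH; apply/eqP; rewrite -subr_eq0.
rewrite -[X in _ == X]oppr0 -(thD (u *+ m) (u *+ n) u) /coboundary3.
by rewrite mulrnDr -mulrSr; apply/eqP; ring.
Qed.

(** On the multiples of u the cocycle is a coboundary except for the carries:
    the exponents x and y add up to x + y or to x + y + p, and in the second
    case the p-th power of (u, 0) splits off. *)
Lemma partial_power_carry u (x y : F) :
  theta (u *+ val x) (u *+ val y) =
  partial_power u (val (x + y)) - partial_power u (val x)
  - partial_power u (val y) + pth_power theta u * carry x y.
Proof.
have [k -> h] := carry_nat x y.
have -> : pth_power theta u * k%:R = partial_power u (p * k).
  elim: k {h} => [|k IH]; first by rewrite muln0 mulr0 /partial_power big_ord0.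
  rewrite mulnS partial_powerD mulr_p th0 -IH mulrSr /pth_power /partial_power.
  by ring.
have := partial_powerD u (val x) (val y); rewrite h partial_powerD.
rewrite mulrnA mulr_p mul0rn (thC _ 0) th0 addr0 => e.
apply: (addrI (partial_power u (val x) + partial_power u (val y))).
by rewrite -e; ring.
Qed.

(** This is (ab)(cd) = (ac)(bd) in an abelian group. *)
Lemma cocycle_exchange a b c d :
  theta (a + b) (c + d) = theta a c + theta b d + theta (a + c) (b + d)
                          - theta a b - theta c d.
Proof.
apply/eqP; rewrite -subr_eq0; apply/eqP.
have h1 := thD a b (c + d); have h2 := thD a c (b + d).
have h3 := thD b c d; have h4 := thD c b d.
rewrite -[RHS](_ : D a c (b + d) - D a b (c + d) + (D b c d - D c b d) = 0);
  last first.
  by rewrite h1 h2 h3 h4 !subrr addr0.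
rewrite /coboundary3 (addrCA c b d) (addrC c b) (thC c b); ring.
Qed.

(** Choosing the products of powers (e1, 0)^i (e2, 0)^j with 0 <= i, j < p as
    representatives of the elements of U makes the cocycle a combination of
    the two carries. *)
Lemma cocycle_trivial : exists tau : U -> F, forall u v,
  theta u v = pth_power theta e1 * carry u.1 v.1
              + pth_power theta e2 * carry u.2 v.2 + coboundary2 tau u v.
Proof.
pose t1 (x : F) := partial_power e1 (val x).
pose t2 (x : F) := partial_power e2 (val x).
exists (fun u => t1 u.1 + t2 u.2 + theta (e1 *+ val u.1) (e2 *+ val u.2)) => u v.
rewrite {1}(pairE u) {1}(pairE v) cocycle_exchange !partial_power_carry.
have -> : e1 *+ val u.1 + e1 *+ val v.1 = e1 *+ val (u + v).1.
  by rewrite !pair_mulrn !natr_val !mul0rn; congr pair => //; exact: addr0.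
have -> : e2 *+ val u.2 + e2 *+ val v.2 = e2 *+ val (u + v).2.
  by rewrite !pair_mulrn !natr_val !mul0rn; congr pair => //; exact: addr0.
rewrite /coboundary2 /t1 /t2 /=; ring.
Qed.

End Cocycle.

Lemma power_coboundary2 (tau : U -> F) u : pth_power (coboundary2 tau) u = 0.
Proof.
have h n :
    \sum_(k < n) coboundary2 tau (u *+ k) u = tau (u *+ n) - tau 0 - tau u *+ n.
  elim: n => [|n IH]; first by rewrite big_ord0 !mulr0n !subrr.
  by rewrite big_ord_recr IH /= /coboundary2 !mulrSr; ring.
by rewrite /pth_power h mulr_p subrr sub0r -mulr_natr natr_p mulr0 oppr0.
Qed.

Lemma coboundary3_coboundary2 (tau : U -> F) a b c :
  coboundary3 (coboundary2 tau) a b c = 0.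
Proof. by rewrite /coboundary3 /coboundary2 !addrA; ring. Qed.

End Symmetric.

(** The standard cocycle with the same associators leaves a cocycle of abelian
    groups, whose carries account for the difference of the p-th powers; these
    agree at e1 and e2 because the cubic part of a standard cocycle vanishes
    on the axes. *)
Lemma cohomologous_std theta :
  (forall u v, theta u v = theta v u) -> (forall v, theta 0 v = 0) ->
  (forall a b, {morph coboundary3 theta a b : c d / c + d}) ->
  exists tau : U -> F, forall u v,
  theta u v = std_cocycle (pth_power theta e1, pth_power theta e2)
     (- coboundary3 theta e1 e1 e2, - coboundary3 theta e1 e2 e2) u v
    + coboundary2 tau u v.
Proof.
move=> thC th0 th3; set P := (pth_power theta e1, _); set L := (- _, _).
have D3 := coboundary3_trilinear thC th3.
pose d u v := theta u v - std_cocycle P L u v.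
have dC u v : d u v = d v u by rewrite /d thC std_sym.
have d0 v : d 0 v = 0 by rewrite /d th0 std0 subrr.
have dD a b c : coboundary3 d a b c = 0.
  have -> : coboundary3 d a b c =
      coboundary3 theta a b c - coboundary3 (std_cocycle P L) a b c.
    by rewrite /coboundary3 /d; ring.
  by rewrite D3 coboundary3_std /L /dot /=; ring.
have [tau htau] := cocycle_trivial dC d0 dD.
have dP u : pth_power d u = pth_power theta u - pth_power (std_cocycle P L) u.
  by rewrite /pth_power -sumrB.
exists tau => u v; rewrite -[LHS](subrK (std_cocycle P L u v)) -/(d u v) htau !dP.
rewrite !power_std /dot /=; ring.
Qed.

End Cochains.

(** * Loop isomorphisms *)

Lemma isomorphic_sym (A B : magmaType) : isomorphic A B -> isomorphic B A.
Proof.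
move=> [f [[g fK gK] fM]]; exists g; split; first by exists f.
by move=> x y; apply: (can_inj fK); rewrite fM !gK.
Qed.

Lemma isomorphic_trans (A B C : magmaType) :
  isomorphic A B -> isomorphic B C -> isomorphic A C.
Proof.
move=> [f [fb fM]] [g [gb gM]]; exists (g \o f); split; first exact: bij_comp.
by move=> x y; rewrite /= fM gM.
Qed.

Lemma isomorphic_associative (A B : magmaType) : isomorphic A B ->
  associative (@mulg A) <-> associative (@mulg B).
Proof.
suff h C D : isomorphic C D -> associative (@mulg C) -> associative (@mulg D).
  by move=> AB; split; apply: h; last apply: isomorphic_sym.
move=> [f [[g fK gK] fM]] CA x y z.
by rewrite -[x]gK -[y]gK -[z]gK -!fM CA.
Qed.

(** * Central extensions of Z_p x Z_p by Z_p *)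

(** A type of its own for each theta keeps this product apart from the
    componentwise one. *)
Definition ext (p : nat) (theta : 'F_p * 'F_p -> 'F_p * 'F_p -> 'F_p) : Type :=
  ('F_p * 'F_p * 'F_p)%type.

Definition ext_mul (p : nat) (theta : 'F_p * 'F_p -> 'F_p * 'F_p -> 'F_p)
    (x y : ext theta) : ext theta :=
  (x.1 + y.1, x.2 + y.2 + theta x.1 y.1).

HB.instance Definition _ p theta := Choice.on (@ext p theta).
HB.instance Definition _ p theta :=
  hasMul.Build (@ext p theta) (@ext_mul p theta).

Section Extensions.
Variable p : nat.
Hypothesis p_pr : prime p.
Notation F := 'F_p.
Notation U := ('F_p * 'F_p)%type.
Implicit Types (u v w a b c : U) (theta : U -> U -> F) (P L : U).

Lemma extM theta (x y : ext theta) :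
  (x * y)%g = (x.1 + y.1, x.2 + y.2 + theta x.1 y.1) :> ext theta.
Proof. by []. Qed.

(** A coboundary is absorbed by the shear (u, s) |-> (u, s - tau u). *)
Lemma ext_cohomologous theta theta' tau :
  (forall u v, theta u v = theta' u v + coboundary2 tau u v) ->
  isomorphic (ext theta) (ext theta').
Proof.
move=> e; exists (fun x => (x.1, x.2 - tau x.1)); split.
  exists (fun x => (x.1, x.2 + tau x.1)) => -[u s] /=; first by rewrite subrK.
  by rewrite addrK.
by move=> [u s] [v t]; rewrite !extM /= e /coboundary2; congr pair; ring.
Qed.

(** The linear map with e1 |-> a and e2 |-> c. *)
Definition basis_map a c u : U := (a.1 * u.1 + c.1 * u.2, a.2 * u.1 + c.2 * u.2).

Lemma basis_mapD a c : {morph basis_map a c : u v / u + v}.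
Proof. by move=> u v; congr pair; rewrite /=; ring. Qed.

Lemma basis_map_mulrn a c u n : basis_map a c (u *+ n) = basis_map a c u *+ n.
Proof.
elim: n => [|n IH]; last by rewrite !mulrS basis_mapD IH.
by rewrite /basis_map !mulr0n /= !mulr0 !addr0.
Qed.

Lemma det2_basis_map a c u v :
  det2 (basis_map a c u) (basis_map a c v) = det2 a c * det2 u v.
Proof. by rewrite /det2 /=; ring. Qed.

Lemma basis_map_e1 a c : basis_map a c (e1 p) = a.
Proof. by case: a c => a1 a2 [c1 c2]; congr pair; rewrite /=; ring. Qed.

Lemma basis_map_e2 a c : basis_map a c (e2 p) = c.
Proof. by case: a c => a1 a2 [c1 c2]; congr pair; rewrite /=; ring. Qed.

Lemma ext_basis_map theta a c : det2 a c != 0 ->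
  isomorphic (ext theta)
    (ext (fun u v => theta (basis_map a c u) (basis_map a c v))).
Proof.
move=> d0; apply: isomorphic_sym.
exists (fun x => (basis_map a c x.1, x.2)); split.
  pose d := det2 a c.
  (* Cramer's rule *)
  pose inv u : U := (det2 u c / d, det2 a u / d).
  exists (fun x => (inv x.1, x.2)) => -[[x y] s]; congr (_, _, _).
  - by rewrite /= -[RHS](mulfK d0); congr (_ / _); rewrite /det2 /=; ring.
  - by rewrite /= -[RHS](mulfK d0); congr (_ / _); rewrite /det2 /=; ring.
  - rewrite /= !mulrA -mulrDl -[RHS](mulfK d0).
    by congr (_ / _); rewrite /det2 /=; ring.
  - rewrite /= !mulrA -mulrDl -[RHS](mulfK d0).
    by congr (_ / _); rewrite /det2 /=; ring.
by move=> x y; rewrite !extM /= basis_mapD.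
Qed.

(** The pulled back cocycle is again symmetric with trilinear coboundary, hence
    cohomologous to a standard one, and its p-th powers and associators at e1
    and e2 are those of the original cocycle at a and c. *)
Lemma ext_std_basis_map P L a c : det2 a c != 0 ->
  isomorphic (ext (std_cocycle P L))
    (ext (std_cocycle
       (pth_power (std_cocycle P L) a, pth_power (std_cocycle P L) c)
       (det2 a c * dot L a, det2 a c * dot L c))).
Proof.
move=> d0; apply: isomorphic_trans (ext_basis_map _ d0) _.
set theta := fun u v => _.
have D3 u v w : coboundary3 theta u v w =
    - (det2 a c * det2 u w * dot L (basis_map a c v)).
  rewrite -det2_basis_map -(coboundary3_std p_pr P).
  by rewrite /coboundary3 /theta !basis_mapD.
have Pe u : pth_power theta u = pth_power (std_cocycle P L) (basis_map a c u).
  by apply: eq_bigr => k _; rewrite /theta basis_map_mulrn.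
have [] := @cohomologous_std p p_pr theta.
- by move=> u v; rewrite /theta std_sym.
- by move=> v; rewrite /theta -[0](mulr0n v) basis_map_mulrn mulr0n std0.
- move=> u v w w'; rewrite !D3 /det2 /=; ring.
move=> tau; rewrite !Pe !D3 !basis_map_e1 !basis_map_e2 !opprK.
have -> : det2 (e1 p) (e2 p) = 1 by rewrite /det2 /=; ring.
by rewrite !mulr1; apply: ext_cohomologous.
Qed.

Definition mk_ext theta u (s : F) : ext theta := (u, s).

Lemma ext_associator theta :
  (forall v, theta 0 v = 0) -> (forall u v, theta u v = theta v u) ->
  forall a b c r s t,
  (mk_ext theta a r * mk_ext theta b s * mk_ext theta c t)%g =
  (mk_ext theta a r * (mk_ext theta b s * mk_ext theta c t)
   * mk_ext theta 0 (- coboundary3 theta a b c))%g.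
Proof.
move=> th0 thC a b c r s t; rewrite !extM /=; congr pair.
  by rewrite addr0 addrA.
by rewrite (thC _ 0) th0 /coboundary3; ring.
Qed.

Lemma ext_std_assoc P L :
  associative (@mulg (ext (std_cocycle P L))) <-> L = 0.
Proof.
split=> [h|->].
  have D b : dot L b = 0.
    have := h (mk_ext _ (e1 p) 0) (mk_ext _ b 0) (mk_ext _ (e2 p) 0).
    rewrite (ext_associator (std0 P L) (std_sym P L)).
    rewrite !extM /= coboundary3_std // => /(congr1 snd) /=.
    rewrite (std_sym _ _ _ 0) std0 addr0 opprK.
    set X := (X in X = _ -> _) => e; have : X - X = 0 by rewrite subrr.
    by rewrite {1}e /X /det2 /= => <-; ring.
  case: L D {h} => l1 l2 D; congr pair.
    by rewrite -(D (e1 p)) /dot /=; ring.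
  by rewrite -(D (e2 p)) /dot /=; ring.
move=> [a r] [b s] [c t].
have e := ext_associator (std0 P 0) (std_sym P 0) a b c r s t.
rewrite [RHS]e.
rewrite [RHS]extM /= coboundary3_std // [RHS]surjective_pairing /=; congr pair.
  by rewrite addr0.
by rewrite (std_sym _ _ _ 0) std0 /dot /=; ring.
Qed.

(** As L is nonzero, the associators of the first extension are all the
    elements (0, t). An isomorphism h sends them to associators of the second,
    hence it has the form h(u, t) = (g u, sigma u + k t) with g linear. Then
    k times the first cocycle and the pullback by g of the second differ by
    the coboundary of sigma, which neither p-th powers nor associators
    notice. *)
Lemma ext_std_iso P L P' L' : L != 0 ->
  isomorphic (ext (std_cocycle P L)) (ext (std_cocycle P' L')) ->
  exists a c (k : F), [/\ det2 a c != 0, k != 0,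
    forall u, k * pth_power (std_cocycle P L) u =
              pth_power (std_cocycle P' L') (basis_map a c u)
    & forall u, k * dot L u = det2 a c * dot L' (basis_map a c u)].
Proof.
move=> L0 [h [hb hM]].
have hi := bij_inj hb.
have [b Lb] := dot_eq1 L0.
have h0 t : (h (mk_ext _ 0 t)).1 = 0.
  have e : - coboundary3 (std_cocycle P L) (t, 0) b (e2 p) = t.
    by rewrite coboundary3_std // Lb /det2 /=; ring.
  have := ext_associator (std0 P L) (std_sym P L) (t, 0) b (e2 p) 0 0 0.
  rewrite e => /(congr1 h); rewrite !hM => /(congr1 fst) /= /eqP.
  by rewrite addrA -subr_eq0 opprD addNKr oppr_eq0 => /eqP.
pose g u := (h (mk_ext _ u 0)).1; pose sigma u := (h (mk_ext _ u 0)).2.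
pose kappa t := (h (mk_ext _ 0 t)).2.
have th'0 v : std_cocycle P' L' v 0 = 0 by rewrite std_sym std0.
have hE u t : h (mk_ext _ u t) = mk_ext _ (g u) (sigma u + kappa t).
  have -> : mk_ext (std_cocycle P L) u t = (mk_ext _ u 0 * mk_ext _ 0 t)%g.
    by rewrite extM /= addr0 std_sym std0 add0r addr0.
  by rewrite hM extM h0 addr0 th'0 addr0.
have kappaD s t : kappa (s + t) = kappa s + kappa t.
  have e : mk_ext (std_cocycle P L) 0 (s + t) = (mk_ext _ 0 s * mk_ext _ 0 t)%g.
    by rewrite extM /= addr0 std0 addr0.
  by rewrite /kappa e hM extM /= !h0 th'0 addr0.
pose k := kappa 1.
have kE t : kappa t = k * t.
  have D (u v : U) : kappa (u + v).1 = kappa u.1 + kappa v.1 by rewrite kappaD.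
  by rewrite (additive_dot D (t, 0)) /= mul0r addr0 mulrC.
have k0 : k != 0.
  apply/eqP => k0; have := oner_neq0 F.
  rewrite -[X in X != _]/((mk_ext (std_cocycle P L) 0 1).2).
  suff -> : mk_ext (std_cocycle P L) 0 1 = mk_ext _ 0 0 by rewrite eqxx.
  by apply: hi; rewrite !hE !kE k0 !mul0r.
have gs u v : g (u + v) = g u + g v /\
    k * std_cocycle P L u v =
    std_cocycle P' L' (g u) (g v) - coboundary2 sigma u v.
  have := hM (mk_ext _ u 0) (mk_ext _ v 0).
  have -> : (mk_ext _ u 0 * mk_ext _ v 0)%g =
      mk_ext (std_cocycle P L) (u + v) (std_cocycle P L u v).
    by rewrite extM /= !add0r.
  rewrite hE kE => e; split; first by rewrite [LHS](congr1 fst e).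
  have /= e2 := congr1 snd e.
  by rewrite /coboundary2 -[LHS](addKr (sigma (u + v))) e2 /sigma /g; ring.
have gE : g =1 basis_map (g (e1 p)) (g (e2 p)).
  move=> u; rewrite [LHS]surjective_pairing /basis_map.
  have D1 (v w : U) : (g (v + w)).1 = (g v).1 + (g w).1 by rewrite (gs v w).1.
  have D2 (v w : U) : (g (v + w)).2 = (g v).2 + (g w).2 by rewrite (gs v w).1.
  by rewrite (additive_dot D1) (additive_dot D2); congr pair; rewrite /=; ring.
have L3 u : k * dot L u = det2 (g (e1 p)) (g (e2 p)) * dot L' (g u).
  have := coboundary3_std p_pr P' L' (g (e1 p)) (g u) (g (e2 p)).
  have := coboundary3_std p_pr P L (e1 p) u (e2 p).
  have -> : det2 (e1 p) (e2 p) = 1 by rewrite /det2 /=; ring.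
  rewrite mul1r => e e'; apply: oppr_inj; rewrite -e' -mulrN -e /coboundary3.
  rewrite -!(gs _ _).1.
  have gse u' v' : std_cocycle P' L' (g u') (g v') =
      k * std_cocycle P L u' v' + coboundary2 sigma u' v'.
    by rewrite (gs _ _).2 subrK.
  by rewrite !gse /coboundary2 !(addrA (e1 p)); ring.
exists (g (e1 p)), (g (e2 p)), k; split=> //.
- by apply: contraNneq k0 => d0; have := L3 b; rewrite Lb d0 mul0r mulr1 => ->.
- move=> u; rewrite -gE.
  have <- : pth_power (std_cocycle P' L') (g u) - pth_power (coboundary2 sigma) u
            = pth_power (std_cocycle P' L') (g u).
    by rewrite power_coboundary2 // subr0.
  rewrite /pth_power mulr_sumr -sumrB; apply: eq_bigr => i _.
  have gM n : g (u *+ n) = g u *+ n.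
    elim: n => [|n IH]; first exact: h0.
    by rewrite !mulrS (gs _ _).1 IH.
  by rewrite (gs _ _).2 gM.
- by move=> u; rewrite -gE.
Qed.

End Extensions.

(** * Loops as central extensions *)

Section Loops.
Local Open Scope quotient_scope.
Variable p : nat.
Hypothesis p_pr : prime p.
Notation F := 'F_p.
Notation U := ('F_p * 'F_p)%type.
Implicit Types (u v w a b c : U) (theta : U -> U -> F) (P L : U).

(** The first isomorphism theorem. The map s is a section of f on underlying
    sets. *)
Lemma loop_quot_ext (Q : loopType) (Z : centralSubloop Q) theta
    (f : Q -> ext theta) (s : ext theta -> Q) :
  (forall v, theta v 0 = 0) -> cancel s f -> {morph f : x y / (x * y)%g} ->
  (forall x, x \in Z <-> f x = (0, 0)) ->
  isomorphic (loop_quot Z) (ext theta).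
Proof.
move=> th0 sK fM fZ.
have piP x y : \pi_(loop_quot Z) x = \pi_(loop_quot Z) y <-> f x = f y.
  have fxy : f y = ext_mul (f x) (f (ldiv x y)).
    by rewrite -[LHS](congr1 f (ldivK x y)) fM.
  have piE : \pi_(loop_quot Z) x = \pi_(loop_quot Z) y <-> ldiv x y \in Z.
    by split=> [/eqmodP|h]; last apply/eqmodP.
  rewrite piE fZ fxy; split=> [->|].
    by rewrite /ext_mul /= th0 !addr0 [LHS]surjective_pairing.
  case: (f x) (f (ldiv x y)) => u r [v t]; rewrite /ext_mul /= => e.
  have v0 : v = 0 by apply: (addrI u); rewrite addr0; exact: esym (congr1 fst e).
  move: (congr1 snd e); rewrite /= v0 th0 addr0 => e2.
  by congr pair; apply: (addrI r); rewrite addr0; exact: esym e2.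
have reprP x : f (repr (\pi_(loop_quot Z) x)) = f x by apply/piP; rewrite reprK.
exists (fun x => f (repr x)); split.
  exists (fun x => \pi_(loop_quot Z) (s x)) => x; last by rewrite reprP sK.
  by rewrite -[RHS]reprK; apply/piP; rewrite sK.
by move=> x y; rewrite -fM -[x in LHS]reprK -[y in LHS]reprK -pi_mulE reprP.
Qed.

(** Here the extension is a vector space of dimension 3. A nonzero linear form
    that vanishes on the two generators has a proper subloop as its kernel. *)
Lemma std00_not_two_generated (Q : loopType) :
  isomorphic Q (ext (std_cocycle (0 : U) 0)) -> ~ two_generated Q.
Proof.
move=> [r [[r' rK r'K] rM]] [a [b gen]].
pose M : 'M[F]_(3, 2) := \matrix_(i, j)
  let x := if j == 0 then r a else r b in [:: x.1.1; x.1.2; x.2]`_i.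
have [w w0 wM] : exists2 w : 'rV[F]_3, w != 0 & w *m M = 0.
  have : kermx M != 0.
    rewrite -mxrank_eq0 mxrank_ker -lt0n subn_gt0.
    exact: leq_ltn_trans (rank_leq_col M) _.
  by case/rowV0Pn=> w /sub_kermxP wM w0; exists w.
pose f x := w 0 0 * (r x).1.1 + w 0 1 * (r x).1.2 + w 0 2 * (r x).2.
have fM x y : f (x * y)%g = f x + f y.
  by rewrite /f rM extM /std_cocycle /=; ring.
have f1 : f 1%g = 0 by apply: (addrI (f 1%g)); rewrite -fM mulg1 addr0.
pose S : {pred Q} := [pred x | f x == 0].
have Sc : subloop_closed S.
  split; rewrite ?inE ?f1 // => x y; rewrite !inE => /eqP fx /eqP fy.
  - by rewrite fM fx fy addr0.
  - by have := fM x (ldiv x y); rewrite ldivK fx fy add0r => <-.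
  - by have := fM (rdiv x y) y; rewrite rdivK fx fy addr0 => <-.
have sumE (j : 'I_2) :
    (w *m M) 0 j = w 0 0 * M 0 j + w 0 1 * M 1 j + w 0 2 * M 2 j.
  rewrite mxE !big_ord_recl big_ord0 addr0 addrA.
  by congr (_ + w 0 _ * M _ _ + w 0 _ * M _ _); exact: val_inj.
have fa : a \in S.
  by rewrite inE; have := sumE 0; rewrite wM !mxE /= => e; apply/eqP; exact: esym e.
have fb : b \in S.
  by rewrite inE; have := sumE 1; rewrite wM !mxE /= => e; apply/eqP; exact: esym e.
have all0 x y z : w 0 0 * x + w 0 1 * y + w 0 2 * z = 0.
  have := gen S Sc fa fb (r' (x, y, z)).
  by rewrite inE /f r'K => /eqP.
case/eqP: w0; apply/rowP => -[[|[|[|//]]] i3]; rewrite mxE.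
- by rewrite -(all0 1 0 0) mulr1 !mulr0 !addr0; congr (w 0 _); apply: val_inj.
- by rewrite -(all0 0 1 0) mulr1 !mulr0 addr0 add0r; congr (w 0 _); apply: val_inj.
- by rewrite -(all0 0 0 1) mulr1 !mulr0 !add0r; congr (w 0 _); apply: val_inj.
Qed.

Definition central_form P L (v : 'rV[F]_6) : F :=
  P.1 * v 0 2 + P.2 * v 0 3 + L.1 * v 0 4 + L.2 * v 0 5.

(** The form (P, L) on the center extends to a homomorphism eta from F_p onto
    the standard extension. Its kernel is N0, and N is the image of N0 under
    an automorphism h, so eta composed with the inverse of h has kernel N. *)
Lemma orbit_quot_ext P L (N0 : {vspace 'rV[F]_6}) (N : centralSubloop (Floop p)) :
  (P, L) != 0 ->
  (forall v : 'rV[F]_6, v \in N0 <->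
     [/\ v 0 0 = 0, v 0 1 = 0 & central_form P L v = 0]) ->
  in_GLorbit N0 N -> isomorphic (loop_quot N) (ext (std_cocycle P L)).
Proof.
move=> PL0 N0P [rho [h [[[h' hK h'K] hM] _ _] hN]].
(* An element of the center at which the form is 1; its multiples provide the
   section. *)
have [[[[z3 z4] z5] z6] z1] : exists z : F * F * F * F,
    P.1 * z.1.1.1 + P.2 * z.1.1.2 + L.1 * z.1.2 + L.2 * z.2 = 1.
  have [P0|/dot_eq1[u Pu]] := eqVneq P 0; last first.
    by exists (u, 0, 0); rewrite /= !mulr0 !addr0.
  have [|u Lu] := @dot_eq1 _ L; first by apply: contraNneq PL0 => ->; rewrite P0.
  by exists (0, 0, u.1, u.2); rewrite /= !mulr0 !add0r.
pose eta (v : Floop p) : ext (std_cocycle P L) :=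
  ((v 0 0, v 0 1), central_form P L v).
have etaM : {morph eta : v w / (v * w)%g}.
  move=> v w; rewrite extM /eta /= /central_form.
  have -> : (v * w)%g = F_mul v w by [].
  by rewrite /F_mul !vec6E /std_cocycle /=; congr pair; ring.
pose s (x : ext (std_cocycle P L)) : Floop p :=
  vec6 x.1.1 x.1.2 (x.2 * z3) (x.2 * z4) (x.2 * z5) (x.2 * z6).
have sK : cancel s eta.
  case=> [[x y] t]; rewrite /eta /s /central_form /= !vec6E; congr pair.
  by rewrite -[RHS]mulr1 -z1 /=; ring.
have h'M : {morph h' : v w / (v * w)%g}.
  by move=> v w; apply: (can_inj hK); rewrite hM !h'K.
apply: (@loop_quot_ext _ N _ (eta \o h') (h \o s)).
- by move=> v; rewrite std_sym std0.
- by move=> x; rewrite /= hK sK.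
- by move=> v w; rewrite /= h'M etaM.
move=> v; rewrite hN; split=> [[u /N0P[u0 u1 fu] ->]|e].
  by rewrite /= hK /eta u0 u1 fu.
exists (h' v); last by rewrite h'K.
apply/N0P; split.
- exact: (congr1 (fun x => x.1.1) e).
- exact: (congr1 (fun x => x.1.2) e).
- exact: (congr1 snd e).
Qed.

(** Representatives s u of the cosets of Z give theta as the factor set
    s(u) s(v) = s(u+v) theta(u,v). In these coordinates the inner map attached
    to (b,0) and (a,0) translates (c,t) by the coboundary of theta at (a,b,c);
    that it is a homomorphism says that the coboundary is additive in c. *)
Lemma class_A_ext (Q : loopType) : class_A p Q ->
  exists theta, [/\ forall u v, theta u v = theta v u, forall v, theta 0 v = 0,
    forall a b, {morph coboundary3 theta a b : c d / c + d}
    & isomorphic Q (ext theta)].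
Proof.
move=> [_ QC Qaut [Z [[zeta [[zeta' zetaK zeta'K] zetaM]] ]]].
case=> [om [[om' omK om'K] omM]].
pose z t : Q := val (zeta' t).
have zZ t : z t \in Z by apply: subloop_valP.
have zM s t : z (s + t) = (z s * z t)%g.
  rewrite /z -valM; congr val; apply: (can_inj zetaK).
  by rewrite zetaM !zeta'K.
pose zc x : F := if insub x is Some y then zeta y else 0.
have zcK x : x \in Z -> z (zc x) = x.
  by move=> xZ; rewrite /zc /z; case: insubP => [y _ <-|/negP//]; rewrite zetaK.
have zK t : zc (z t) = t by rewrite /zc /z valK zeta'K.
have z0 : z 0 = 1%g.
  by rewrite -[LHS](ldivKV (z 0)) -zM addr0 -{2}(mulg1 (z 0)) ldivKV.
pose pr x : U := om (\pi_(loop_quot Z) x).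
have prM x y : pr (x * y)%g = pr x + pr y by rewrite /pr pi_mulE omM.
have prE x y : pr x = pr y <-> ldiv x y \in Z.
  rewrite /pr; split=> [/(can_inj omK)/eqmodP //|h].
  by congr om; apply/eqmodP.
have pr1 : pr 1%g = 0 by apply: (addrI (pr 1%g)); rewrite -prM mulg1 addr0.
(* The value 1 at 0 normalises theta. *)
pose s u : Q := if u == 0 then 1%g else repr (om' u).
have s0 : s 0 = 1%g by rewrite /s eqxx.
have sK u : pr (s u) = u.
  by rewrite /s; case: eqP => [->|_] //; rewrite /pr reprK om'K.
pose theta u v := zc (ldiv (s (u + v)) (s u * s v)%g).
have sM u v : (s u * s v)%g = (s (u + v) * z (theta u v))%g.
  by rewrite zcK ?ldivK //; apply/prE; rewrite prM !sK.
have cen t x y := csl_central (zZ t) x y.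
have zC t x : (z t * x)%g = (x * z t)%g by case: (cen t x x).
have zA t x y : (x * (y * z t))%g = (x * y * z t)%g by case: (cen t x y).
have zA' t x y : (x * z t * y)%g = (x * y * z t)%g.
  by case: (cen t x y) => _ _ <- _; rewrite zC zA.
pose q (x : ext theta) : Q := (s x.1 * z x.2)%g.
pose r x : ext theta := (pr x, zc (ldiv (s (pr x)) x)).
have prz t : pr (z t) = 0.
  rewrite -pr1; apply/esym/prE.
  by have [_ _ h _] := subloopP Z; apply: h => //; have [] := subloopP Z.
have rK : cancel r q.
  by move=> x; rewrite /q /r /= zcK ?ldivK //; apply/prE; rewrite sK.
have qK : cancel q r.
  by move=> [u t]; rewrite /q /r /= prM sK prz addr0 ldivKV zK.
have qM : {morph q : x y / (x * y)%g}.
  move=> [u a] [v b]; rewrite extM /q /= zA' zA sM -zA -zM -zA -zM.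
  by congr (_ * z _)%g; rewrite /=; ring.
have qi := can_inj qK.
have thC u v : theta u v = theta v u.
  have := QC (q (u, 0)) (q (v, 0)); rewrite -!qM => /qi /(congr1 snd) /=.
  by rewrite !add0r.
have th0 v : theta 0 v = 0.
  have e : q (0, 0) = 1%g by rewrite /q /= s0 z0 mulg1.
  have := mul1g (q (v, 0)); rewrite -e -qM => /qi /(congr1 snd) /=.
  by rewrite !add0r.
exists theta; split=> //; last first.
  by exists r; split; [exists q | move=> x y; apply: qi; rewrite qM !rK].
move=> a b c d.
have [_ fM] := Qaut _ (inner_L (q (b, 0)) (q (a, 0))).
set f := (X in {morph X : _ _ / _ >-> _}) in fM.
have fE e t : f (q (e, t)) = q (e, t + coboundary3 theta a b e).
  rewrite /f /= /Ltrans -[RHS](ldivKV (q (a, 0) * q (b, 0))%g) -!qM !extM /=.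
  by congr (ldiv _ (q (_, _))); rewrite ?addrA // /coboundary3; ring.
have := fM (q (c, 0)) (q (d, 0)); rewrite -qM extM !fE -qM => /qi /(congr1 snd) /=.
rewrite !add0r addrC => /addIr; apply.
Qed.

End Loops.

(** * The orbit representatives as kernels *)

(** The pair (P, L) for which the i-th orbit representative is the kernel of
    the central form. All indices outside 1, ..., 4 share one value. *)
Definition orbit_form (p : nat) (lambda : 'F_p) (i : nat) :
    ('F_p * 'F_p) * ('F_p * 'F_p) :=
  match i with
  | 1 => ((0, 1), (0, 0))
  | 2 => ((0, 0), (0, 1))
  | 3 => if p == 3 then ((1, 0), (0, -1)) else ((0, 1), (0, -1))
  | 4 => if p == 3 then ((1, 0), (0, 1)) else ((1, 0), (0, -1))
  | _ => if p == 3 then ((1, -1), (0, 1)) else ((1, 0), (0, - lambda))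
  end.

Section Classification.
Variable p : nat.
Hypothesis p_pr : prime p.
Notation F := 'F_p.
Notation U := ('F_p * 'F_p)%type.
Implicit Types (a c P L : U) (lambda : F).

Lemma span3P (x y z v : 'rV[F]_6) :
  reflect (exists k l m, v = k *: x + (l *: y + m *: z))
          (v \in (<[x]> + (<[y]> + <[z]>))%VS).
Proof.
apply: (iffP memv_addP) => [[_ /vlineP[k ->] [w]]|[k [l [m ->]]]].
  case/memv_addP=> _ /vlineP[l ->] [_ /vlineP[m ->] ->] ->.
  by exists k, l, m.
exists (k *: x); first by rewrite memvZ ?memv_line.
by exists (l *: y + m *: z); rewrite // memv_add ?memvZ ?memv_line.
Qed.

(** When the form vanishes at v the correction terms disappear and v is the
    combination of x, y, z with coefficients k, l, m. With the corrections
    t2, t3, t5 the coordinate equations hold for arbitrary v, so that for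
    concrete x, y, z they are ring identities. *)
Lemma span3_central_form P L (x y z v : 'rV[F]_6) k l m t2 t3 t5 :
  let g (w : 'rV[F]_6) := central_form P L w in
  let ok (w : 'rV[F]_6) := [/\ w 0 0 = 0, w 0 1 = 0 & g w = 0] in
  let w := k *: x + (l *: y + m *: z) in
  [/\ ok x, ok y & ok z] ->
  [/\ w 0 2 = v 0 2 + t2 * g v, w 0 3 = v 0 3 + t3 * g v,
      w 0 4 = v 0 4 & w 0 5 = v 0 5 + t5 * g v] ->
  v \in (<[x]> + (<[y]> + <[z]>))%VS <-> ok v.
Proof.
move=> g ok w [[x0 x1 gx] [y0 y1 gy] [z0 z1 gz]] [w2 w3 w4 w5].
split=> [/span3P[k' [l' [m' ->]]]|[v0 v1 gv]].
  split; rewrite ?mxE ?x0 ?x1 ?y0 ?y1 ?z0 ?z1 ?mulr0 ?addr0 //.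
  transitivity (k' * g x + (l' * g y + m' * g z)); last first.
    by rewrite gx gy gz !mulr0 !addr0.
  by rewrite /g /central_form !mxE /=; ring.
apply/span3P; exists k, l, m; rewrite -/w [LHS]vec6_eta [RHS]vec6_eta.
have [-> ->] : w 0 0 = 0 /\ w 0 1 = 0.
  by rewrite !mxE x0 x1 y0 y1 z0 z1 !mulr0 !addr0.
by rewrite w2 w3 w4 w5 gv v0 v1 !mulr0 !addr0.
Qed.

Ltac check_coords := do !split; rewrite ?mxE /central_form ?mxE /=; ring.

Lemma orbit_repP lambda i (v : 'rV[F]_6) : (1 <= i <= 5)%N ->
  v \in orbit_rep lambda i <->
  [/\ v 0 0 = 0, v 0 1 = 0
    & central_form (orbit_form lambda i).1 (orbit_form lambda i).2 v = 0].
Proof.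
case: i => [|[|[|[|[|[|]]]]]] //= _; rewrite /spaceV /spaceW.
- by apply: (@span3_central_form _ _ _ _ _ _ (v 0 2) (v 0 4) (v 0 5) 0 (-1) 0);
    check_coords.
- rewrite -addvA.
  by apply: (@span3_central_form _ _ _ _ _ _ (v 0 2) (v 0 3) (v 0 4) 0 0 (-1));
    check_coords.
- case: (p == 3); rewrite !span_cons span_nil addv0.
    by apply: (@span3_central_form _ _ _ _ _ _ (v 0 2) (v 0 3) (v 0 4) 0 0 1);
      check_coords.
  by apply: (@span3_central_form _ _ _ _ _ _ (v 0 2) (v 0 3) (v 0 4) 0 0 1);
    check_coords.
- case: (p == 3); rewrite !span_cons span_nil addv0.
    by apply: (@span3_central_form _ _ _ _ _ _ (v 0 2) (v 0 3) (v 0 4) 0 0 (-1));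
      check_coords.
  by apply: (@span3_central_form _ _ _ _ _ _ (v 0 3) (v 0 2) (v 0 4) 0 0 1);
    check_coords.
- case: (p == 3); rewrite !span_cons span_nil addv0.
    by apply: (@span3_central_form _ _ _ _ _ _ (v 0 2) (v 0 3) (v 0 4) 0 0 (-1));
      check_coords.
  by apply: (@span3_central_form _ _ _ _ _ _ (v 0 3) (v 0 5) (v 0 4) (-1) 0 0);
    check_coords.
Qed.

End Classification.

(** * Orbits of the pairs (P, L) for p different from 3 *)

(** In a cyclic group of units the nonsquares are odd powers of a
    generator. *)
Lemma mul_nonsquare (K : finFieldType) (x y : K) :
  ~ (exists z, x = z ^+ 2) -> ~ (exists z, y = z ^+ 2) ->
  exists z, x * y = z ^+ 2.
Proof.
move=> nx ny.
have sq0 : exists z : K, 0 = z ^+ 2 by exists 0; rewrite expr0n.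
have x0 : x != 0 by apply/eqP => x0; apply: nx; rewrite x0.
have y0 : y != 0 by apply/eqP => y0; apply: ny; rewrite y0.
have [g gE] : exists g : {unit K}, forall u : {unit K}, exists n, u = (g ^+ n)%g.
  have /cyclicP[g gE] := field_unit_group_cyclic [set: {unit K}]%G.
  by exists g => u; apply/cycleP; rewrite -gE inE.
have odd_pow (z : K) : z != 0 -> ~ (exists w, z = w ^+ 2) ->
    exists n, z = val g ^+ (n.*2.+1).
  rewrite -unitfE => zU ns; have [n e] := gE (FinRing.unit K zU).
  have {e}zE : z = val g ^+ n by rewrite -FinRing.val_unitX -e.
  exists n./2; rewrite zE -[in LHS](odd_double_half n).
  case: (boolP (odd n)) => // /negPf e; case: ns; exists (val g ^+ n./2).
  by rewrite zE -exprM muln2 -{1}(odd_double_half n) e.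
have [[m ->] [n ->]] := (odd_pow x x0 nx, odd_pow y y0 ny).
by exists (val g ^+ (m + n).+1); rewrite -exprD -exprM; congr (_ ^+ _); lia.
Qed.

Section Reduction.
Variable p : nat.
Hypothesis p_pr : prime p.
Notation F := 'F_p.
Notation U := ('F_p * 'F_p)%type.
Implicit Types (a c P L : U) (lambda : F).

(** In each case the new basis (a, c) is chosen so that P and L become the rows
    of the representative. When P and L are independent, their kernels must be
    spanned by c and a, respectively; the remaining freedom of scaling c by s
    multiplies det(P, L) by the square of s, and -1 or -lambda can be reached
    because lambda represents the nonsquares. *)
Lemma reach_orbit_form lambda P L : p != 3 ->
  ((3 < p)%N -> ~ exists mu : F, lambda = mu ^+ 2) -> (P, L) != 0 ->
  exists i, (1 <= i <= num_orbits p)%N /\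
    isomorphic (ext (std_cocycle P L))
      (ext (std_cocycle (orbit_form lambda i).1 (orbit_form lambda i).2)).
Proof.
move=> p3 nsq PL0.
have step a c : det2 a c != 0 -> isomorphic (ext (std_cocycle P L))
    (ext (std_cocycle (dot P a, dot P c) (det2 a c * dot L a, det2 a c * dot L c))).
  have E u : dot P u = pth_power (std_cocycle P L) u.
    by rewrite power_std // sum_consecutive0 // mul0r addr0.
  by rewrite !E; apply: ext_std_basis_map.
have n4 i : (1 <= i <= 4)%N -> (1 <= i <= num_orbits p)%N.
  by rewrite /num_orbits; case: eqP => _; lia.
have use i a c : (1 <= i <= num_orbits p)%N -> det2 a c != 0 ->
    (dot P a, dot P c, (det2 a c * dot L a, det2 a c * dot L c))
      = orbit_form lambda i ->
    exists i, (1 <= i <= num_orbits p)%N /\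
    isomorphic (ext (std_cocycle P L))
      (ext (std_cocycle (orbit_form lambda i).1 (orbit_form lambda i).2)).
  by move=> hi d0 e; exists i; split=> //; rewrite -e; apply: step.
have [P0|P0] := eqVneq P 0.
  have [|c Lc] := @dot_eq1 _ L; first by apply: contraNneq PL0 => ->; rewrite P0.
  have d1 : det2 (L.2, - L.1) c = 1 by rewrite -Lc /dot /det2 /=; ring.
  apply: (use 2%N (L.2, - L.1) c); [exact: n4 | by rewrite d1 oner_eq0 |].
  by rewrite d1 Lc P0 /dot /=; congr (_, _, (_, _)); ring.
have [c Pc] := dot_eq1 P0.
have detP t : det2 (t * P.2, - (t * P.1)) c = t.
  by rewrite -[RHS]mulr1 -Pc /dot /det2 /=; ring.
have dotP t : dot P (t * P.2, - (t * P.1)) = 0 by rewrite /dot /=; ring.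
have [L0|L0] := eqVneq L 0.
  apply: (use 1%N (1 * P.2, - (1 * P.1)) c).
  - exact: n4.
  - by rewrite detP oner_eq0.
  by rewrite dotP Pc L0 /dot /=; congr (_, _, (_, _)); ring.
have [D0|D0] := eqVneq (det2 P L) 0.
  pose r := dot L c.
  have LE : L = (r * P.1, r * P.2).
    rewrite [LHS]surjective_pairing; congr pair; rewrite -[LHS]mulr1 -Pc /r.
      by rewrite -[RHS]subr0 -[X in _ - X](mul0r c.2) -D0 /dot /det2; ring.
    by rewrite -[RHS]addr0 -[X in _ + X](mul0r c.1) -D0 /dot /det2; ring.
  have r0 : r != 0 by apply: contraNneq L0 => r0; rewrite LE r0 !mul0r.
  apply: (use 3%N (- r^-1 * P.2, - (- r^-1 * P.1)) c).
  - exact: n4.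
  - by rewrite detP oppr_eq0 invr_eq0.
  have -> : dot L (- r^-1 * P.2, - (- r^-1 * P.1)) = 0 by rewrite LE /dot /=; ring.
  by rewrite dotP Pc detP -/r mulr0 mulNr mulVf //= (negPf p3).
pose D := det2 P L.
have sqr_use s i : (1 <= i <= num_orbits p)%N -> s != 0 ->
    orbit_form lambda i = ((1, 0), (0, s ^+ 2 * D)) ->
    exists i, (1 <= i <= num_orbits p)%N /\
    isomorphic (ext (std_cocycle P L))
      (ext (std_cocycle (orbit_form lambda i).1 (orbit_form lambda i).2)).
  move=> hi s0 e; pose a : U := (D^-1 * L.2, - (D^-1 * L.1)).
  pose c' : U := (- (s * P.2), s * P.1).
  have d : det2 a c' = s.
    by rewrite -[RHS]mulr1 -(mulVf D0) -/D /D /det2 /=; ring.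
  apply: (use i a c' hi); rewrite d // e /dot /=; congr (_, _, (_, _)).
  - by rewrite -(mulVf D0) -/D /D /det2 /=; ring.
  - ring.
  - ring.
  - by rewrite /D /det2; ring.
have sqE (x : F) : (exists s, - x / D = s ^+ 2) -> x != 0 ->
    exists2 s, s != 0 & - x = s ^+ 2 * D.
  move=> [s e] x0; have e' : - x = s ^+ 2 * D by rewrite -e divfK.
  exists s => //; apply: contraNneq x0 => s0.
  by rewrite -oppr_eq0 e' s0 expr0n mul0r.
have [/existsP[s0 /eqP e0]|ns] := boolP [exists s : F, -1 / D == s ^+ 2].
  have [||s sn0 e] := sqE 1; rewrite ?oner_eq0 //; first by exists s0.
  by apply: (sqr_use s 4%N) => //; [exact: n4 | rewrite -e /= (negPf p3)].
have {}ns : ~ exists s, -1 / D = s ^+ 2.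
  by case=> s e; case/negP: ns; apply/existsP; exists s; apply/eqP.
(* Every element of F_2 is its own square. *)
have p2 : p != 2.
  apply/eqP => p2; apply: ns; exists (-1 / D).
  rewrite -[-1 / D]natr_val; have : (val (-1 / D)%R < 2)%N.
    by have := val_lt p_pr (-1 / D); rewrite [X in (_ < X)%N]p2.
  by case: (val _) => [|[|]] // _; rewrite ?expr0n ?expr1n.
have p_gt3 : (3 < p)%N by have := prime_gt1 p_pr; lia.
have [z ez] := mul_nonsquare (nsq p_gt3) ns.
have [||s sn0 e] := sqE lambda; first by exists z; rewrite -ez; ring.
  by apply/eqP => l0; apply: (nsq p_gt3); exists 0; rewrite l0 expr0n.
apply: (sqr_use s 5%N) => //; first by rewrite /num_orbits (negPf p2).
by rewrite -e /= (negPf p3).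
Qed.

(** What survives of the orbit of (P, L) under base changes and scalings: whether
    P vanishes, and det(P, L) up to squares. *)
Lemma ext_std_iso_linear P L P' L' : p != 3 -> L != 0 ->
  isomorphic (ext (std_cocycle P L)) (ext (std_cocycle P' L')) ->
  (P = 0 -> P' = 0) /\
  exists2 r : F, r != 0 & det2 P L = r ^+ 2 * det2 P' L'.
Proof.
move=> p3 L0 iso.
have [a [c [k [d0 k0 hP hL]]]] := ext_std_iso p_pr L0 iso.
have E u : pth_power (std_cocycle P L) u = dot P u.
  by rewrite power_std // sum_consecutive0 // mul0r addr0.
have E' u : pth_power (std_cocycle P' L') u = dot P' u.
  by rewrite power_std // sum_consecutive0 // mul0r addr0.
have Pa : k * P.1 = dot P' a.
  by have := hP (e1 p); rewrite E E' basis_map_e1 => <-; rewrite /dot /=; ring.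
have Pc : k * P.2 = dot P' c.
  by have := hP (e2 p); rewrite E E' basis_map_e2 => <-; rewrite /dot /=; ring.
have La : k * L.1 = det2 a c * dot L' a.
  by have := hL (e1 p); rewrite basis_map_e1 => <-; rewrite /dot /=; ring.
have Lc : k * L.2 = det2 a c * dot L' c.
  by have := hL (e2 p); rewrite basis_map_e2 => <-; rewrite /dot /=; ring.
have DD : k ^+ 2 * det2 P L = det2 a c ^+ 2 * det2 P' L'.
  transitivity ((k * P.1) * (k * L.2) - (k * P.2) * (k * L.1)).
    by rewrite /det2; ring.
  by rewrite Pa Pc La Lc /dot /det2; ring.
split; last first.
  exists (det2 a c / k); first by rewrite mulf_neq0 ?invr_eq0.
  apply: (mulfI (expf_neq0 2 k0)).
  by rewrite DD expr_div_n [RHS]mulrCA [RHS]mulrA divfK ?expf_neq0.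
move=> P0; rewrite P0 /= !mulr0 in Pa Pc.
rewrite [LHS]surjective_pairing; congr pair; apply: (mulfI d0).
  transitivity (dot P' a * c.2 - dot P' c * a.2); first by rewrite /dot /det2; ring.
  by rewrite -Pa -Pc !mul0r subrr mulr0.
transitivity (dot P' c * a.1 - dot P' a * c.1); first by rewrite /dot /det2; ring.
by rewrite -Pa -Pc !mul0r subrr mulr0.
Qed.

Lemma orbit_form_snd_eq0 lambda i :
  ((3 < p)%N -> ~ exists mu : F, lambda = mu ^+ 2) ->
  (1 <= i <= num_orbits p)%N -> ((orbit_form lambda i).2 == 0) = (i == 1%N).
Proof.
move=> nsq; rewrite /num_orbits.
have nz (x : F) : x != 0 -> ((0, x) == 0 :> U) = false.
  by move=> x0; apply: contra_neqF x0 => /eqP/(congr1 snd).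
have n1 : -1 != 0 :> F by rewrite oppr_eq0 oner_eq0.
case: i => [|[|[|[|[|[|i]]]]]] //=.
- by move=> _; case: (p == 3); exact: nz.
- by move=> _; case: (p == 3); apply: nz; rewrite ?oner_eq0.
- have [//|p2] := eqVneq p 2.
  have [_|p3] := eqVneq p 3 => _; apply: nz; first exact: oner_neq0.
  rewrite oppr_eq0; apply/eqP => l0; apply: nsq.
    by have := prime_gt1 p_pr; lia.
  by exists 0; rewrite l0 expr0n.
- by case: (p == 2).
Qed.

(** P vanishes only in the second representative, det(P, L) is zero in the
    third, -1 in the fourth and -lambda in the fifth. *)
Lemma separate_orbit_form lambda i j : p != 3 ->
  ((3 < p)%N -> ~ exists mu : F, lambda = mu ^+ 2) ->
  (2 <= i < j)%N -> (j <= num_orbits p)%N ->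
  ~ isomorphic (ext (std_cocycle (orbit_form lambda i).1 (orbit_form lambda i).2))
      (ext (std_cocycle (orbit_form lambda j).1 (orbit_form lambda j).2)).
Proof.
move=> p3 nsq /andP[i2 ij] jn.
have j5 : (j <= 5)%N by move: jn; rewrite /num_orbits; case: ifP => _; lia.
have j5p : j = 5%N -> (3 < p)%N.
  move: jn (prime_gt1 p_pr); rewrite /num_orbits; case: eqP => p2 *; lia.
have ij_cases : [\/ i = 2 /\ j \in [:: 3; 4; 5]%N, i = 3 /\ j \in [:: 4; 5]%N
    | i = 4 /\ j = 5]%N.
  rewrite !inE.
  by case: (ltngtP i 3) => ?; [apply: Or31|apply: Or33|apply: Or32]; lia.
have n1 : -1 != 0 :> F by rewrite oppr_eq0 oner_eq0.
have nz (x : F) : x != 0 -> (0, x) != 0 :> U by apply: contra_neq => /(congr1 snd).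
have nzl (x : F) : (1, x) != 0 :> U.
  by apply/eqP => /(congr1 fst)/eqP; rewrite oner_eq0.
have l0 : (3 < p)%N -> lambda != 0.
  by move=> /nsq ns; apply/eqP => l0; apply: ns; exists 0; rewrite l0 expr0n.
have E1 (x : F) : det2 (1, 0) (0, x) = x by rewrite /det2 /=; ring.
have L0 : (orbit_form lambda i).2 != 0.
  by rewrite orbit_form_snd_eq0 //; lia.
move=> /(ext_std_iso_linear p3 L0)[h [r r0]].
case: ij_cases => -[Ei]; rewrite ?inE; rewrite Ei /= in h *.
- have P0 : (orbit_form lambda j).1 = 0 := h erefl.
  case/or3P => /eqP Ej _; move: P0; rewrite Ej /= ?(negPf p3) /=; apply/eqP.
  - by rewrite nz ?oner_eq0.
  - by rewrite nzl.
  - by rewrite nzl.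
- have E0 : det2 (0, 1) (0, -1) = 0 :> F by rewrite /det2 /=; ring.
  rewrite (negPf p3) E0 => /orP[] /eqP Ej; rewrite Ej /= (negPf p3) E1 => /esym/eqP.
    by rewrite mulf_eq0 expf_eq0 (negPf r0) (negPf n1) andbF.
  by rewrite mulf_eq0 expf_eq0 (negPf r0) oppr_eq0 (negPf (l0 (j5p Ej))) andbF.
- move=> Ej; rewrite Ej /= (negPf p3) !E1 mulrN => /oppr_inj e.
  apply: (nsq (j5p Ej)); exists r^-1.
  by apply: (mulfI (expf_neq0 2 r0)); rewrite -e -exprMn divff // expr1n.
Qed.

End Reduction.

(** * Orbits of the pairs (P, L) for p = 3 *)

Definition seq3 : seq 'F_3 := [:: 0; 1; -1].

Definition seq33 : seq ('F_3 * 'F_3) := [seq (x, y) | x <- seq3, y <- seq3].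
Lemma mem_seq3 (x : 'F_3) : x \in seq3.
Proof. by case: x => -[|[|[|//]]] h; rewrite !inE -!val_eqE. Qed.

Lemma mem_seq33 u : u \in seq33.
Proof. by case: u => x y; apply: allpairs_f; apply: mem_seq3. Qed.

(** An odd function on F_3 x F_3, linear up to the cubic part; it stands for
    the p-th power map in the enumerations, where it evaluates without a
    sum. *)
Definition pth_power3 (PL : ('F_3 * 'F_3) * ('F_3 * 'F_3))
    (u : 'F_3 * 'F_3) : 'F_3 :=
  dot PL.1 u - u.1 * u.2 * (PL.2.2 * u.2 - PL.2.1 * u.1).

Lemma power_std3 (P L u : 'F_3 * 'F_3) :
  pth_power (std_cocycle P L) u = pth_power3 (P, L) u.
Proof.
rewrite (@power_std 3) // /pth_power3 /=.
have -> : sum_consecutive 3 = -1.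
  by rewrite /sum_consecutive !big_ord_recl big_ord0; apply: val_inj.
by rewrite mulN1r.
Qed.

(** Every nonzero pair (P, L) over F_3 is carried to a representative by some
    change of basis (a, c). *)
Definition F3_form_reach : bool :=
  all (fun P => all (fun L => ((P, L) == 0) ||
    has (fun i => has (fun a => has (fun c =>
      [&& det2 a c != 0,
          (pth_power3 (P, L) a, pth_power3 (P, L) c) == (orbit_form 1 i).1
        & (det2 a c * dot L a, det2 a c * dot L c) == (orbit_form 1 i).2])
      seq33) seq33) [:: 1; 2; 3; 4; 5]%N) seq33) seq33.

(* Lazy evaluation leaves alone the bound proofs inside the elements of F_3. *)
Lemma F3_form_reachT : F3_form_reach.
Proof. by lazy. Qed.

(** The p-th power maps of two representatives with L <> 0 are never related by
    a change of basis (a, c) and a scalar k: they have different numbers of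
    zeros. *)
Definition F3_form_separate : bool :=
  all (fun j => all (fun i => (i < j)%N ==>
    all (fun a => all (fun c => (det2 a c == 0) ||
      all (fun k => (k == 0) ||
        has (fun u => k * pth_power3 (orbit_form 1 i) u
                      != pth_power3 (orbit_form 1 j) (basis_map a c u))
        seq33) seq3) seq33) seq33) [:: 2; 3; 4; 5]%N) [:: 2; 3; 4; 5]%N.

Lemma F3_form_separateT : F3_form_separate.
Proof. by lazy. Qed.

Lemma orbit_form3 (lambda : 'F_3) i : orbit_form lambda i = orbit_form 1 i.
Proof. by case: i => [|[|[|[|[|i]]]]]. Qed.

Lemma reach_orbit_form3 (lambda : 'F_3) (P L : 'F_3 * 'F_3) : (P, L) != 0 ->
  exists i, (1 <= i <= num_orbits 3)%N /\
    isomorphic (ext (std_cocycle P L))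
      (ext (std_cocycle (orbit_form lambda i).1 (orbit_form lambda i).2)).
Proof.
move=> PL0.
have /allP/(_ P (mem_seq33 P))/allP/(_ L (mem_seq33 L)) := F3_form_reachT.
case/orP=> [|/hasP[i i5 /hasP[a _ /hasP[c _ /and3P[d0 /eqP e1 /eqP e2]]]]].
  by rewrite (negPf PL0).
exists i; split; first by move: i5; rewrite !inE => /or4P[|||/orP[]] /eqP->.
rewrite orbit_form3 -e1 -e2 -!power_std3.
exact: (ext_std_basis_map (isT : prime 3)).
Qed.

Lemma separate_orbit_form3 (lambda : 'F_3) i j :
  (2 <= i < j)%N -> (j <= 5)%N ->
  ~ isomorphic (ext (std_cocycle (orbit_form lambda i).1 (orbit_form lambda i).2))
      (ext (std_cocycle (orbit_form lambda j).1 (orbit_form lambda j).2)).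
Proof.
move=> /andP[i2 ij] j5.
have mem n : (2 <= n <= 5)%N -> n \in [:: 2; 3; 4; 5]%N by rewrite !inE; lia.
have mi : i \in [:: 2; 3; 4; 5]%N by apply: mem; lia.
have mj : j \in [:: 2; 3; 4; 5]%N by apply: mem; lia.
have L0 : (orbit_form lambda i).2 != 0.
  by rewrite (orbit_form_snd_eq0 (isT : prime 3)) //; rewrite /num_orbits /=; lia.
rewrite !orbit_form3 in L0 *.
move=> /(ext_std_iso (isT : prime 3) L0)[a [c [k [d0 k0 hP _]]]].
have /allP/(_ _ mj)/allP/(_ _ mi)/implyP/(_ ij) := F3_form_separateT.
move=> /allP/(_ _ (mem_seq33 a))/allP/(_ _ (mem_seq33 c)).
case/orP=> [|/allP/(_ _ (mem_seq3 k))/orP[|/hasP[u _ /negP[]]]].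
- by rewrite (negPf d0).
- by rewrite (negPf k0).
have := hP u; rewrite !power_std3 -!surjective_pairing => ->; exact: eqxx.
Qed.

(** * The classification *)

Theorem theorem6p1 (p : nat) (p_prime : prime p) (lambda : 'F_p)
    (lambda_nonsquare : (3 < p)%N -> ~ exists mu : 'F_p, lambda = mu ^+ 2)
    (N : nat -> centralSubloop (Floop p))
    (N_orbit : forall i : nat, (1 <= i <= num_orbits p)%N ->
                 in_GLorbit (orbit_rep lambda i) (N i)) :
  (forall Q : loopType, class_A p Q ->
     exists! i : nat, (1 <= i <= num_orbits p)%N
                      /\ isomorphic Q (loop_quot (N i)))
  /\ (forall i : nat, (1 <= i <= num_orbits p)%N ->
        (is_group (loop_quot (N i)) <-> i = 1%N)).
Proof.
pose E i := ext (std_cocycle (orbit_form lambda i).1 (orbit_form lambda i).2).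
have le5 i : (1 <= i <= num_orbits p)%N -> (1 <= i <= 5)%N.
  by rewrite /num_orbits; case: ifP => _; lia.
have snd0 i := orbit_form_snd_eq0 p_prime (i := i) lambda_nonsquare.
have NE i : (1 <= i <= num_orbits p)%N -> isomorphic (loop_quot (N i)) (E i).
  move=> hi; apply: orbit_quot_ext (N_orbit i hi).
    rewrite -surjective_pairing; have [->|i1] := eqVneq i 1%N.
      by apply/eqP => /(congr1 (fun x => x.1.2)) /eqP; rewrite oner_eq0.
    apply: contraNneq i1 => e; rewrite -snd0 // e; exact: eqxx.
  by move=> v; apply: orbit_repP; apply: le5.
have grp i : (1 <= i <= num_orbits p)%N -> (is_group (loop_quot (N i)) <-> i = 1%N).
  move=> hi; apply: iff_trans (isomorphic_associative (NE i hi)) _.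
  apply: iff_trans (ext_std_assoc p_prime _ _) _.
  by split=> /eqP; [rewrite snd0 // => /eqP | move=> i1; apply/eqP; rewrite snd0].
have reach (P L : 'F_p * 'F_p) : (P, L) != 0 ->
    exists i, (1 <= i <= num_orbits p)%N /\
    isomorphic (ext (std_cocycle P L)) (E i).
  have [p3|p3] := eqVneq p 3; last first.
    exact: (reach_orbit_form p_prime p3 lambda_nonsquare).
  by subst p; exact: reach_orbit_form3.
have sep i j : (2 <= i < j)%N -> (j <= num_orbits p)%N ->
    ~ isomorphic (E i) (E j).
  have [p3|p3] := eqVneq p 3; last first.
    exact: (separate_orbit_form p_prime p3 lambda_nonsquare).
  by subst p; exact: separate_orbit_form3.
split=> // Q QA.
have [theta [thC th0 th3 iso]] := class_A_ext QA.
have [tau htau] := cohomologous_std p_prime thC th0 th3.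
set P := (pth_power theta _, _) in htau; set L := (- _, _) in htau.
have isoPL : isomorphic Q (ext (std_cocycle P L)).
  exact: isomorphic_trans iso (ext_cohomologous htau).
have PL0 : (P, L) != 0.
  apply/eqP => e; move: isoPL (congr1 fst e) (congr1 snd e) => /= + P0 L0.
  rewrite P0 L0 => iso0.
  by case: QA => gen _ _ _; exact: std00_not_two_generated iso0 gen.
have [i [hi isoi]] := reach P L PL0.
have Qi : isomorphic Q (loop_quot (N i)).
  exact: isomorphic_trans (isomorphic_trans isoPL isoi) (isomorphic_sym (NE i hi)).
exists i; split=> // j [hj Qj].
have NN : isomorphic (loop_quot (N i)) (loop_quot (N j)).
  exact: isomorphic_trans (isomorphic_sym Qi) Qj.
have one_ij : i = 1%N <-> j = 1%N.
  by rewrite -grp // -grp //; exact: isomorphic_associative NN.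
have EE : isomorphic (E i) (E j).
  apply: isomorphic_trans (isomorphic_sym (NE i hi)) _.
  exact: isomorphic_trans NN (NE j hj).
(* The first index is settled by associativity, the others by sep. *)
case: (ltngtP i j) => // ij; exfalso.
  have i1 : i <> 1%N by move=> /[dup] /one_ij; lia.
  by apply: (sep i j) => //; lia.
have j1 : j <> 1%N by move=> /[dup] /one_ij; lia.
by apply: (sep j i); [lia | lia | exact: isomorphic_sym].
Qed.
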